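(* Let $\{\lambda_n\}$ be any strictly increasing sequence of stopping times and $\{h_n(X_0,\dots,X_{\lambda_n})\}$ any sequence of estimators such that for all stationary and ergodic binary Markov chains $\{X_n\}$ of arbitrary finite order, almost surely, $$\lim_{n\to\infty}\frac{\lambda_n}{n}=1\quad\text{and}\quad \lim_{n\to\infty}\left|h_n(X_0,\dots,X_{\lambda_n})-K(X_{-\infty}^{\lambda_n})\right|=0 .$$ Then there is a stationary, ergodic, finitarily Markovian binary time series $\{X_n\}$ such that on a set of positive measure of process realizations $$h_n(X_0,\dots,X_{\lambda_n})\ne K(X_{-\infty}^{\lambda_n})\quad\text{for infinitely many } n.$$
   Context: Binary means $\{0,1\}$-valued. The stopping times and the estimators are universal, i.e. they are fixed functions of the observed sequence $X_0,X_1,X_2,\dots$ not depending on the distribution of the process: the event $\{\lambda_n=m\}$ is determined by $(X_0,\dots,X_m)$, and $h_n$ is a function of $(X_0,\dots,X_{\lambda_n})$. Memory length: write $X_m^n=(X_m,\dots,X_n)$ (empty string if $m>n$), $p(\cdot)$ for the probability of a finite string, and $p(y|x_{-k}^0)=P(X_1=y\mid X_{-k}^0=x_{-k}^0)$ (with $p(y|\emptyset)=P(X_1=y)$). $K(X_{-\infty}^0)$ is the smallest $0\le K<\infty$ such that for all $i\ge1$, all letters $y$ and all strings $z_{-K-i+1}^{-K}$ of length $i$, $p(y|X_{-K+1}^0)=p(y|z_{-K-i+1}^{-K},X_{-K+1}^0)$ provided $p(z_{-K-i+1}^{-K},X_{-K+1}^0,y)>0$; $K(X_{-\infty}^0)=\infty$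 if there is no such $K$. $K(X_{-\infty}^m)$ is the same function applied to the past of time $m$ (i.e. to the shifted sequence). A stationary process is finitarily Markovian if $K(X_{-\infty}^0)<\infty$ almost surely. *)

(* Defs.v *)
From HB Require Import structures.
From mathcomp Require Import all_boot all_order all_algebra.
From mathcomp Require Import all_classical all_reals all_analysis.
Set Implicit Arguments.
Unset Strict Implicit.
Unset Printing Implicit Defensive.
Import Order.TTheory GRing.Theory Num.Theory.
Import numFieldNormedType.Exports.
Local Open Scope classical_set_scope.
Local Open Scope ring_scope.

(* Words are listed in increasing order of time. *)
Definition block (x : int -> bool) (s : int) (k : nat) : seq bool :=
  mkseq (fun i => x (s + i%:Z)) k.

(* X_{m-k+1}^m *)
Definition last_block (x : int -> bool) (m : int) (k : nat) : seq bool :=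
  block x (m - k%:Z + 1) k.

Definition shift_path (x : int -> bool) : int -> bool := fun i => x (i + 1).

(* The product sigma-algebra of {0,1}^Z. *)
Definition path_measurable : set (set (int -> bool)) :=
  <<s [set A | exists (i : int) (b : bool), A = [set x | x i = b]] >>.

Section Process.
Context {R : realType} {d : measure_display} {T : measurableType d}.
Variables (P : probability T R) (X : int -> {RV P >-> bool}).

Definition sample_path (t : T) : int -> bool := fun i => X i t.

Definition block_event (s : int) (w : seq bool) : set T :=
  [set t | block (sample_path t) s (size w) = w].

Definition stationary : Prop :=
  forall (s : int) (w : seq bool),
    P (block_event s w) = P (block_event 0 w).

Definition ergodic : Prop :=
  forall A : set (int -> bool), path_measurable A -> shift_path @^-1` A = A ->
    P (sample_path @^-1` A) = 0%E \/ P (sample_path @^-1` A) = 1%E.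

(* p(w); used for stationary processes only, so the starting time 0 is
   immaterial. *)
Definition word_prob (w : seq bool) : R := fine (P (block_event 0 w)).

(* p(y|w); only meaningful when p(w) > 0. *)
Definition cond_prob (w : seq bool) (y : bool) : R :=
  word_prob (rcons w y) / word_prob w.

(* Order at most k; order 0 means independent. *)
Definition markov_order (k : nat) : Prop :=
  forall (z w : seq bool) (y : bool), size w = k ->
    0 < word_prob (z ++ w) -> cond_prob (z ++ w) y = cond_prob w y.

Definition is_memory (x : int -> bool) (m : int) (k : nat) : Prop :=
  forall (z : seq bool) (y : bool), (0 < size z)%N ->
    0 < word_prob (rcons (z ++ last_block x m k) y) ->
    cond_prob (last_block x m k) y = cond_prob (z ++ last_block x m k) y.

(* K(x_{-oo}^m), with None standing for infinity. *)
Definition memory_length (x : int -> bool) (m : int) : option nat :=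
  if pselect (exists k, `[< is_memory x m k >]) is left e
  then Some (ex_minn e) else None.

Definition finitarily_markovian : Prop :=
  {ae P, forall t, memory_length (sample_path t) 0 <> None}.

Definition observed (t : T) : nat -> bool := fun i => X i%:Z t.

End Process.

Definition xnat_ereal {R : realType} (o : option nat) : \bar R :=
  if o is Some k then (k%:R)%:E else +oo%E.

(* Times are functions of a one-sided sequence; None means "never stops".
   Infinite values matter: by compactness of {0,1}^N, a stopping time which is
   finite on every single sequence is bounded. *)
Definition stopping_time (tau : (nat -> bool) -> option nat) : Prop :=
  forall (m : nat) (x y : nat -> bool),
    (forall i, (i <= m)%N -> x i = y i) -> tau x = Some m -> tau y = Some m.

(* Strict where finite; once infinite, infinite from then on. *)
Definition strictly_increasing_times
    (lam : nat -> (nat -> bool) -> option nat) : Prop :=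
  forall (n : nat) (x : nat -> bool) (m' : nat), lam n.+1 x = Some m' ->
    exists2 m, lam n x = Some m & (m < m')%N.

Section Estimation.
Context {R : realType} {d : measure_display} {T : measurableType d}.
Variables (P : probability T R) (X : int -> {RV P >-> bool}).
Variables (lam : nat -> (nat -> bool) -> option nat) (h : nat -> seq bool -> R).

(* |h_n(X_0,...,X_{lam_n}) - K(X_{-oo}^{lam_n})|, infinite if lam_n is. *)
Definition estimation_error (n : nat) (t : T) : \bar R :=
  if lam n (observed X t) is Some m then
    `| (h n (mkseq (observed X t) m.+1))%:E
       - xnat_ereal (memory_length X (sample_path X t) m%:Z) |%E
  else +oo%E.

Definition wrong_estimate (n : nat) (t : T) : Prop :=
  exists2 m, lam n (observed X t) = Some m &
    (h n (mkseq (observed X t) m.+1))%:E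
      <> xnat_ereal (memory_length X (sample_path X t) m%:Z).

End Estimation.

(* Main.v *)
Require Import Defs.
From HB Require Import structures.
From mathcomp Require Import all_boot all_order all_algebra.
From mathcomp Require Import all_classical all_reals all_analysis.
From mathcomp Require Import measurable_realfun zify lra.
Import Order.TTheory GRing.Theory Num.Theory.
Import numFieldNormedType.Exports.
Local Open Scope classical_set_scope.
Local Open Scope ring_scope.

(** The counterexample is a renewal process: when [a] zeros have occurred since
    the last 1 (the age), the next symbol is 1 with probability 1/2 if [a] lies
    in a set [D] of natural numbers, and with probability 1/4 otherwise.

    If all elements of [D] are below [k], then [k] zeros in a row already
    determine the rate 1/4, whatever precedes them. Hence the process is a
    Markov chain of order at most [k] ([renewal_markov]), and its memory length
    after [k] zeros is at most [k]. If [D] and its complement are both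
    unbounded, the opposite holds: a run of zeros never determines the rate,
    since a longer run may have an age in [D] or outside it
    ([zeros_not_memory]). The memory reaches back at most to the last 1, so it
    is almost surely finite, but it exceeds [k] whenever the last [k] symbols
    are zeros.

    All these processes are driven by the same independent fair coins, two at
    each time: the first being tails forces a 0, two heads force a 1, and
    otherwise the age decides. Two heads make the age forget the past;
    therefore two sets which agree below [L] give the same symbols at the times
    [0..N], except with probability at most (N+1) (3/4)^L
    ([renewal_agree_prob]).

    The set [D] is built one element at a time. Suppose that a finite set [s]
    has been chosen, with all elements below [k]. Its process is a finite-order
    chain, on which the estimators are consistent: with probability above 1/2,
    before some finite time [N], there is a stopping time at the end of [k]
    zeros where the guess is below [k+1] ([low_guess_stage]). The next element
    of [D] is taken so large that, with probability at least 3/4, the final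
    process agrees with this chain up to time [N]. So for every stage the final
    process sees such a low guess with probability at least 1/4, and sees low
    guesses at infinitely many stages with probability at least 1/4. All of
    them are wrong, because the memory length of the final process exceeds [k]
    after [k] zeros ([low_guess_wrong]).

    That stopping times do fall at the ends of blocks of [k] zeros is where
    lambda_n / n -> 1 is used. It leaves only a set of density zero of times
    which are not stopping times, while the ends of zero blocks almost surely
    have positive upper density ([dense_times_hit], [frequent_zeros_ae]). For
    the latter, comparing expectations bounds the upper density below with
    positive probability; positivity of the upper density is a shift-invariant
    event, so by ergodicity its probability is 1.

    The fair coins are the binary digits of a uniform variable. Everything
    about their independence is derived from two symmetries of their law,
    flipping one coin and re-indexing injectively ([coins_flip],
    [coins_reindex]). In particular an event which is unaffected by flipping a
    coin is halved by that coin ([flip_half]), which gives the conditional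
    probabilities of the renewal process. *)

(** * Binary digits *)

Section Digits.
Set Implicit Arguments. Unset Strict Implicit.
Context {R : realType}.

Definition weight (n : nat) : R := 2^-1 ^+ n.

Fixpoint dyadic (u : R) (n : nat) : R :=
  if n is m.+1 then
    if dyadic u m + weight m.+1 <= u then dyadic u m + weight m.+1
    else dyadic u m
  else 0.

Definition digit (u : R) (n : nat) : bool := dyadic u n + weight n.+1 <= u.

Lemma weightS n : weight n = weight n.+1 + weight n.+1.
Proof. by rewrite /weight exprS; lra. Qed.

Lemma weight_gt0 n : 0 < weight n.
Proof. by rewrite exprn_gt0. Qed.

Lemma measurable_dyadic n : measurable_fun setT (dyadic ^~ n).
Proof.
elim: n => [|n IH] /=; first exact: measurable_cst.
apply: measurable_fun_ifT => //; last exact: measurable_funD.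
by apply: measurable_fun_ler => //; exact: measurable_funD.
Qed.

Lemma measurable_digit n : measurable [set u | digit u n].
Proof.
have := @measurable_fun_ler _ _ _ setT (fun u => dyadic u n + weight n.+1) id.
move=> /(_ _ _)-/(_ _ _ measurableT [set true]).
rewrite setTI; apply => //; apply: measurable_funD => //.
exact: measurable_dyadic.
Qed.

Definition dyadic_of (y : nat -> bool) (n : nat) : R :=
  \sum_(i < n) (y i)%:R * weight i.+1.

Lemma dyadic_ofS (y : nat -> bool) n :
  dyadic_of y n.+1 = dyadic_of y n + (y n)%:R * weight n.+1.
Proof. by rewrite /dyadic_of big_ord_recr. Qed.

Lemma dyadic_uniq (y : nat -> bool) (u : R) n :
  dyadic_of y n <= u < dyadic_of y n + weight n -> dyadic u n = dyadic_of y n.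
Proof.
elim: n => [|n IH] /=; first by rewrite /dyadic_of big_ord0.
rewrite dyadic_ofS => /andP[h1 h2].
have := weightS n; have := weight_gt0 n.+1 => w0 w1.
rewrite IH; last by move: h1 h2; case: (y n); rewrite ?mul1r ?mul0r; lra.
by move: h1 h2; case: ifP; case: (y n) => /=; lra.
Qed.

(** The first [n] digits select one dyadic interval; this is what makes their
    joint law under the uniform measure computable. *)
Lemma digits_prefix (y : nat -> bool) (u : R) n : 0 <= u < 1 ->
  (forall i, (i < n)%N -> digit u i = y i) <->
  dyadic_of y n <= u < dyadic_of y n + weight n.
Proof.
move=> u01; elim: n => [|n IH].
  by rewrite /dyadic_of big_ord0 add0r /weight expr0.
have := weightS n; have := weight_gt0 n.+1 => w0 w1.
have digitn : dyadic_of y n <= u < dyadic_of y n + weight n ->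
    digit u n = y n <->
    dyadic_of y n.+1 <= u < dyadic_of y n.+1 + weight n.+1.
  move=> K; rewrite dyadic_ofS /digit (dyadic_uniq K); move: K => /andP[h1 h2].
  by case: (y n); rewrite ?mul1r ?mul0r; split; case: leP => //; lra.
split.
  move=> H; apply/digitn; last exact: H.
  by apply/IH => i ni; apply: H; rewrite ltnS ltnW.
move=> K; have K' : dyadic_of y n <= u < dyadic_of y n + weight n.
  by move: K; rewrite dyadic_ofS; case: (y n); rewrite ?mul1r ?mul0r; lra.
move=> i; rewrite ltnS leq_eqVlt => /orP[/eqP->|]; first exact/digitn.
exact: IH.2.
Qed.
End Digits.

(** * The law of independent fair coins *)

Section Coins.
Set Implicit Arguments. Unset Strict Implicit.
Context (R : realType) (I : countType).

Lemma uniform01_itv (a w : R) : 0 <= a -> 0 <= w -> a + w <= 1 ->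
  uniform_prob (@ltr01 R) [set u | a <= u < a + w] = w%:E.
Proof.
move=> a0 w0 aw1; rewrite /uniform_prob integral_uniform_pdf.
rewrite (_ : _ `&` _ = `[a, a + w[%classic); last first.
  apply/seteqP; split => u /=; rewrite !in_itv /=; first by case.
  by move=> /andP[h1 h2]; split; lra.
rewrite (eq_integral (fun=> 1%:E)); last first.
  move=> u; rewrite inE /= in_itv /= => /andP[h1 h2]; rewrite /uniform_pdf subr0.
  by rewrite ifT ?invr1 //; lra.
rewrite integral_cst // mul1e /= lebesgue_measure_itv /= lte_fin.
case: ifPn => [_|]; first by rewrite -EFinB addrAC subrr add0r.
by rewrite -leNgt => h; congr EFin; lra.
Qed.

Definition coin_events : set (set (I -> bool)) :=
  [set A | exists i, A = [set x : I -> bool | x i]].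

Definition coins := g_sigma_algebraType coin_events.

Lemma measurable_coin (i : I) : measurable ([set x | x i] : set coins).
Proof. by apply: sub_sigma_algebra; exists i. Qed.

(** Coins are indexed by an arbitrary countable type, so that a process on the
    integers can be driven by the digits, which are indexed by [nat]. *)
Definition coin_digits (u : R) : coins := fun i => digit u (pickle i).

Lemma measurable_coin_digits :
  @measurable_fun _ _ (g_sigma_algebraType R.-ocitv.-measurable) coins
    setT coin_digits.
Proof.
apply: (@measurability _ _ _ _ setT coin_digits coin_events) => //.
move=> _ [_ [i ->] <-]; rewrite setTI.
exact: measurable_digit.
Qed.

Definition coin_map :
    {mfun g_sigma_algebraType R.-ocitv.-measurable >-> coins} :=
  MeasurableFun.Pack (MeasurableFun.Class
    (isMeasurableFun.Build _ _ (g_sigma_algebraType R.-ocitv.-measurable) coins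
      coin_digits measurable_coin_digits)).

Definition fair_coins : probability coins R :=
  distribution (uniform_prob (@ltr01 R)) coin_map.

Lemma fair_coinsE (A : set coins) :
  fair_coins A = uniform_prob (@ltr01 R) (coin_digits @^-1` A).
Proof. by []. Qed.
End Coins.

(** * Probabilities as real numbers *)

Section RealProb.
Set Implicit Arguments. Unset Strict Implicit.
Context {R : realType} {d : measure_display} {T : measurableType d}.
Context (P : probability T R).
Implicit Types A B : set T.

Definition rprob A : R := fine (P A).

Lemma rprobE A : measurable A -> P A = (rprob A)%:E.
Proof. by move=> mA; rewrite /rprob fineK // fin_num_measure. Qed.

Lemma rprob_ge0 A : 0 <= rprob A.
Proof. by rewrite fine_ge0. Qed.

Lemma rprob_le1 A : measurable A -> rprob A <= 1.
Proof. by move=> mA; rewrite -lee_fin -rprobE // probability_le1. Qed.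

Lemma rprob0 : rprob set0 = 0.
Proof. by rewrite /rprob measure0. Qed.

Lemma rprobT : rprob setT = 1.
Proof. by rewrite /rprob probability_setT. Qed.

Lemma le_rprob A B : measurable A -> measurable B -> A `<=` B ->
  rprob A <= rprob B.
Proof.
move=> mA mB AB; rewrite -lee_fin -!rprobE //.
by apply: le_measure => //; rewrite inE.
Qed.

Lemma rprob_split A B : measurable A -> measurable B ->
  rprob A = rprob (A `&` B) + rprob (A `\` B).
Proof.
move=> mA mB; apply: EFin_inj; rewrite EFinD -!rprobE //.
- by rewrite addeC -(measureDI P mA mB).
- exact: measurableD.
- exact: measurableI.
Qed.

Lemma rprobU_le A B : measurable A -> measurable B ->
  rprob (A `|` B) <= rprob A + rprob B.
Proof.
move=> mA mB.
have mU := measurableU _ _ mA mB.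
rewrite (rprob_split mU mA); apply: lerD.
  by apply: le_rprob => //; exact: measurableI.
by apply: le_rprob => //; [exact: measurableD | move=> x [[]]].
Qed.

Lemma rprobC A : measurable A -> rprob (~` A) = 1 - rprob A.
Proof.
move=> mA; have := @rprob_split setT A measurableT mA.
by rewrite rprobT setTI setTD => ->; rewrite addrAC subrr add0r.
Qed.

Lemma rprobDle A B : measurable A -> measurable B ->
  rprob A <= rprob B + rprob (A `\` B).
Proof.
move=> mA mB; rewrite (rprob_split mA mB) lerD2r.
by apply: le_rprob => //; exact: measurableI.
Qed.

Lemma measurable_setY A B : measurable A -> measurable B -> measurable (A `+` B).
Proof. by move=> mA mB; apply: measurableU; exact: measurableD. Qed.

Lemma rprob_setY_tri A B C : measurable A -> measurable B -> measurable C ->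
  rprob (A `+` C) <= rprob (A `+` B) + rprob (B `+` C).
Proof.
move=> mA mB mC; have mAB := measurable_setY mA mB.
have mBC := measurable_setY mB mC; have mAC := measurable_setY mA mC.
apply: le_trans (rprobU_le mAB mBC); apply: le_rprob => //.
  exact: measurableU.
move=> x; rewrite /setY /=; have [Bx|nBx] := pselect (B x); tauto.
Qed.

(** Replacing an event by a nearby one changes its intersections by at most
    the measure of the symmetric difference. *)
Lemma rprob_distI A B C : measurable A -> measurable B -> measurable C ->
  `| rprob (A `&` C) - rprob (B `&` C) | <= rprob (A `+` B).
Proof.
move=> mA mB mC; have mS := measurable_setY mA mB.
have mAC := measurableI _ _ mA mC; have mBC := measurableI _ _ mB mC.
have h1 := rprobDle mAC mBC; have h2 := rprobDle mBC mAC.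
have h3 : rprob ((A `&` C) `\` (B `&` C)) <= rprob (A `+` B).
  apply: le_rprob => //; first exact: measurableD.
  by move=> x [[Ax Cx] nBC]; left; split => // Bx; exact: nBC.
have h4 : rprob ((B `&` C) `\` (A `&` C)) <= rprob (A `+` B).
  apply: le_rprob => //; first exact: measurableD.
  by move=> x [[Ax Cx] nBC]; right; split => // Bx; exact: nBC.
by rewrite ler_norml; lra.
Qed.

Lemma rprob_bigcup_near (F : nat -> set T) (e : R) : 0 < e ->
  (forall n, measurable (F n)) -> nondecreasing_seq F ->
  exists n, rprob (\bigcup_n F n) - e < rprob (F n).
Proof.
move=> e0 mF ndF; have mU : measurable (\bigcup_n F n) by exact: bigcup_measurable.
have : P \o F @ \oo --> P (\bigcup_n F n) by exact: nondecreasing_cvg_mu.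
rewrite rprobE // => /fine_cvgP[_ /cvgrPdist_lt /(_ _ e0)[N _ /(_ N)]].
rewrite /= leqnn => /(_ isT) h; exists N.
by move: h; rewrite -/(rprob (F N)) ltr_norml; lra.
Qed.

Lemma rprob_bigcap_ge (F : nat -> set T) (c : R) :
  (forall n, measurable (F n)) -> nonincreasing_seq F ->
  (forall n, c <= rprob (F n)) -> c <= rprob (\bigcap_n F n).
Proof.
move=> mF niF cF; have mI : measurable (\bigcap_n F n) by exact: bigcapT_measurable.
rewrite leNgt; apply/negP => h.
have F0 : (P (F 0%N) < +oo)%E by rewrite rprobE // ltry.
have : P \o F @ \oo --> P (\bigcap_n F n) by exact: nonincreasing_cvg_mu.
rewrite rprobE // => /fine_cvgP[_ /cvgrPdist_lt].
rewrite -subr_gt0 in h; move=> /(_ _ h)[N _ /(_ N)].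
rewrite /= leqnn => /(_ isT); rewrite -/(rprob (F N)) ltr_norml.
by have := cF N; lra.
Qed.

(** An event which depends on finitely many boolean variables is a finite
    boolean combination of them: split on one variable at a time. *)
Lemma measurable_local {J : eqType} (f : J -> T -> bool) (s : seq J)
    (Q : (J -> bool) -> Prop) :
  (forall j, measurable [set t | f j t]) ->
  (forall x y, {in s, x =1 y} -> Q x -> Q y) ->
  measurable [set t | Q (f^~ t)].
Proof.
move=> mf; elim: s Q => [|j s IH] Q locQ.
  have [[x Qx]|nQ] := pselect (exists x, Q x).
    have -> : [set t | Q (f^~ t)] = setT.
      by apply/seteqP; split => // t _; apply: locQ Qx.
    exact: measurableT.
  have -> : [set t | Q (f^~ t)] = set0.
    by apply/seteqP; split => // t Qt; apply: nQ; exists (f^~ t).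
  exact: measurable0.
pose set_j b (x : J -> bool) : J -> bool := fun i => if i == j then b else x i.
have -> : [set t | Q (f^~ t)] =
    ([set t | f j t] `&` [set t | Q (set_j true (f^~ t))]) `|`
    (~` [set t | f j t] `&` [set t | Q (set_j false (f^~ t))]).
  have setE t : set_j (f j t) (f^~ t) = f^~ t.
    by apply/funext => i; rewrite /set_j; case: eqP => [->|].
  apply/seteqP; split => t /=.
    have := setE t; case: (f j t) => -> Qt; first by left.
    by right.
  by have := setE t; case: (f j t) => -> [[]|[]].
have mQ b : measurable [set t | Q (set_j b (f^~ t))].
  apply: (IH (fun x => Q (set_j b x))) => x y xy; apply: locQ => i.
  by rewrite inE /set_j; case: eqP => //= _; exact: xy.
by apply: measurableU; apply: measurableI => //; exact: measurableC.
Qed.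

End RealProb.

(** * Cylinders and symmetries of the coins *)

Section CoinCylinders.
Set Implicit Arguments. Unset Strict Implicit.
Context (R : realType).
Local Notation U := (uniform_prob (@ltr01 R)).
Local Notation weight := (@weight R).

Definition digit_cylinder (s : seq nat) (y : nat -> bool) : set R :=
  [set u | {in s, digit u =1 y}].

Lemma rprob_uniform01_itv (a w : R) : 0 <= a -> 0 <= w -> a + w <= 1 ->
  rprob U [set u | a <= u < a + w] = w.
Proof. by move=> a0 w0 aw1; exact: (congr1 fine (uniform01_itv a0 w0 aw1)). Qed.

Lemma measurable_digit_cylinder s y :
  measurable (digit_cylinder s y : set (g_sigma_algebraType R.-ocitv.-measurable)).
Proof.
apply: (@measurable_local _ _ _ (fun n u => digit u n) s
  (fun z => {in s, z =1 y})) => [n|z z' zz' h i si].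
  exact: measurable_digit.
by rewrite -zz' // h.
Qed.

Lemma digit_cylinder_prefix n y :
  rprob U (digit_cylinder (iota 0 n) y) = weight n.
Proof.
have sum_le : 0 <= dyadic_of y n :> R /\ dyadic_of y n + weight n <= 1.
  elim: n => [|n [IH1 IH2]]; first by rewrite /dyadic_of big_ord0 /weight expr0; lra.
  rewrite dyadic_ofS; have := weightS (R := R) n.
  by have := weight_gt0 (R := R) n.+1; case: (y n); rewrite ?mul1r ?mul0r; lra.
have m01 : measurable ([set u | 0 <= u < 0 + 1] : set R).
  rewrite (_ : [set _ | _] = `[0, 0 + 1[%classic) //.
have U01 : rprob U (~` [set u | 0 <= u < 0 + 1]) = 0.
  by rewrite rprobC // rprob_uniform01_itv //; lra.
have w0 := weight_gt0 (R := R) n.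
rewrite (rprob_split U (measurable_digit_cylinder _ _) m01).
have D01 : rprob U (digit_cylinder (iota 0 n) y `\` [set u | 0 <= u < 0 + 1])
    <= rprob U (~` [set u | 0 <= u < 0 + 1]).
  apply: le_rprob.
  - exact: (measurableD (measurable_digit_cylinder _ _) m01).
  - exact: measurableC.
  - by move=> u [].
rewrite U01 in D01.
have -> : rprob U (digit_cylinder (iota 0 n) y `\` [set u | 0 <= u < 0 + 1]) = 0.
  by apply/eqP; rewrite eq_le D01 rprob_ge0.
rewrite addr0.
rewrite (_ : _ `&` _ = [set u | dyadic_of y n <= u < dyadic_of y n + weight n]).
  by apply: rprob_uniform01_itv; lra.
apply/seteqP; split => u /=.
  move=> [Du]; rewrite add0r => u01; apply/(digits_prefix y n u01) => i ni.
  by apply: Du; rewrite mem_iota.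
move=> h; have u01 : 0 <= u < 1 by lra.
rewrite add0r; split => // i; rewrite mem_iota /= => ni.
exact: (digits_prefix y n u01).2.
Qed.

(** A digit can be forgotten by adding the probabilities of its two values. It
    reduces arbitrary finite sets of digits to initial segments. *)
Lemma digit_cylinder_drop i s : i \notin s ->
  (forall y, rprob U (digit_cylinder (i :: s) y) = weight (size s).+1) ->
  forall y, rprob U (digit_cylinder s y) = weight (size s).
Proof.
move=> nsi H y; have mi := measurable_digit (R := R) i.
pose y_ b j := if j == i then b else y j.
rewrite (rprob_split U (measurable_digit_cylinder _ _) mi).
rewrite (weightS (R := R) (size s)).
congr (_ + _).
  rewrite -(H (y_ true)); congr rprob; apply/seteqP; split => u /=.
    move=> [h hi] j; rewrite inE /y_; case: eqP => [->//|_ /= sj]; exact: h.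
  move=> h; split; last by rewrite h ?inE ?eqxx // /y_ eqxx.
  move=> j sj; rewrite h ?inE ?sj ?orbT // /y_; case: eqP => // ij.
  by rewrite -ij sj in nsi.
rewrite -(H (y_ false)); congr rprob; apply/seteqP; split => u /=.
  move=> [h /negP/negbTE hi] j; rewrite inE /y_; case: eqP => [->//|_ /= sj]; exact: h.
move=> h; split; last by rewrite h ?inE ?eqxx // /y_ eqxx.
move=> j sj; rewrite h ?inE ?sj ?orbT // /y_; case: eqP => // ij.
by rewrite -ij sj in nsi.
Qed.

Lemma digit_cylinderE s y : uniq s ->
  rprob U (digit_cylinder s y) = weight (size s).
Proof.
move=> us; pose n := (\max_(i <- s) i).+1.
have sn i : i \in s -> (i < n)%N.
  by move=> si; rewrite ltnS; exact: (leq_bigmax_seq (F := id)).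
pose t := [seq i <- iota 0 n | i \notin s].
have tsP : perm_eq (t ++ s) (iota 0 n).
  apply: uniq_perm; rewrite ?iota_uniq ?cat_uniq ?filter_uniq ?iota_uniq //=.
    rewrite us andbT; apply/hasPn => i si; rewrite mem_filter negb_and negbK.
    by rewrite si.
  move=> i; rewrite mem_cat mem_filter mem_iota /= add0n.
  by case si : (i \in s) => //=; rewrite ?orbF // sn.
have: forall y, rprob U (digit_cylinder (t ++ s) y) = weight (size (t ++ s)).
  move=> z; rewrite (perm_size tsP) size_iota -(digit_cylinder_prefix n z).
  congr rprob; apply/seteqP; split => u /= h i si; apply: h.
    by rewrite (perm_mem tsP).
  by rewrite -(perm_mem tsP).
have: uniq (t ++ s) by rewrite (perm_uniq tsP) iota_uniq.
elim: t {tsP} => [_|i t IH] /=; first exact.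
by move=> /andP[it ut] H; apply: IH => //; exact: digit_cylinder_drop it H.
Qed.

Context (I : countType).
Local Notation P := (fair_coins R I).

Definition cylinder (s : seq I) (y : I -> bool) : set (coins I) :=
  [set x : I -> bool | {in s, x =1 y}].

Lemma measurable_coins_local (s : seq I) (B : set (coins I)) :
  (forall x y : coins I, {in s, x =1 y} -> B x -> B y) -> measurable B.
Proof.
move=> locB.
exact: (@measurable_local _ (coins I) I (fun i x => x i) s B
  (@measurable_coin I) locB).
Qed.

Lemma measurable_cylinder s y : measurable (cylinder s y).
Proof.
apply: (@measurable_coins_local s) => x z xz h i si.
by rewrite -xz // h.
Qed.

Lemma cylinderE s y : uniq s -> rprob P (cylinder s y) = weight (size s).
Proof.
move=> us; pose y' n := if unpickle n is Some i then y i else false.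
rewrite -(size_map pickle) -(@digit_cylinderE _ y').
  rewrite /rprob fair_coinsE; congr (fine (U _)).
  apply/seteqP; split => u /=.
    by move=> h _ /mapP[i si ->]; rewrite /y' pickleK -h.
  by move=> h i si; have := h (pickle i) (map_f _ si); rewrite /y' pickleK.
by rewrite map_inj_uniq //; exact: (pcan_inj pickleK).
Qed.

Lemma measurable_to_coins (phi : coins I -> coins I) :
  (forall i, measurable [set x | phi x i]) -> measurable_fun setT phi.
Proof.
move=> h.
apply: (@measurability _ _ (coins I) (coins I) setT phi (@coin_events I)) => //.
by move=> _ [_ [i ->] <-]; rewrite setTI; exact: h.
Qed.

(** The cylinders prescribing ones only are stable under intersection and
    generate the sigma-algebra, so they determine a finite measure. *)
Lemma coins_measure_unique (m1 m2 : {measure set (coins I) -> \bar R}) :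
  (m1 setT < +oo)%E ->
  (forall s, uniq s -> m1 (cylinder s xpredT) = m2 (cylinder s xpredT)) ->
  forall A, measurable A -> m1 A = m2 A.
Proof.
move=> fin12 E12 A mA.
pose G : set (set (coins I)) := [set B | exists s, B = cylinder s xpredT].
have cyl0 : cylinder [::] xpredT = setT by apply/seteqP; split.
apply: (measure_unique G (fun=> setT)) mA => //.
- apply/seteqP; split.
    apply: smallest_sub; first exact: smallest_sigma_algebra.
    move=> _ [i ->]; apply: sub_sigma_algebra; exists [:: i].
    apply/seteqP; split => x /=; last by move=> /(_ i); rewrite inE eqxx => ->.
    by move=> xi j; rewrite inE => /eqP->.
  apply: smallest_sub; first exact: sigma_algebra_measurable.
  by move=> _ [s ->]; exact: measurable_cylinder.
- move=> _ _ [s ->] [t ->]; exists (s ++ t); apply/seteqP; split => x /=.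
    by move=> [h h'] i; rewrite mem_cat => /orP[]; [exact: h | exact: h'].
  by move=> h; split => i si; apply: h; rewrite mem_cat si ?orbT.
- by move=> i; exists [::].
- by rewrite bigcup_const //; exists 0%N.
- move=> _ [s ->].
  have -> : cylinder s xpredT = cylinder (undup s) xpredT.
    by apply/seteqP; split => x /= h i; have := h i; rewrite mem_undup.
  by rewrite E12 // undup_uniq.
Qed.

Lemma coins_preserved (phi : coins I -> coins I) :
  measurable_fun setT phi ->
  (forall s, uniq s ->
     rprob P (phi @^-1` cylinder s xpredT) = weight (size s)) ->
  forall A, measurable A -> P (phi @^-1` A) = P A.
Proof.
move=> mphi H A mA.
pose mf : {mfun coins I >-> coins I} := MeasurableFun.Pack (MeasurableFun.Class
  (isMeasurableFun.Build _ _ (coins I) (coins I) phi mphi)).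
apply: (@coins_measure_unique (distribution P mf) P) => //.
  by apply: le_lt_trans (ltry 1); exact: probability_le1.
move=> s us; have mc := @measurable_cylinder s xpredT.
have mp : measurable (phi @^-1` cylinder s xpredT).
  by rewrite -[X in measurable X]setTI; exact: (mphi measurableT _ mc).
have := rprobE P mp; rewrite H // => e1.
have := rprobE P mc; rewrite cylinderE // => e2.
exact: (etrans e1 (esym e2)).
Qed.

Definition reindex (f : I -> I) (x : coins I) : coins I := fun i => x (f i).

Lemma coins_reindex f A : injective f -> measurable A ->
  P (reindex f @^-1` A) = P A.
Proof.
move=> finj mA; apply: coins_preserved mA.
  by apply: measurable_to_coins => i; exact: measurable_coin.
move=> s us; have := @cylinderE (map f s) xpredT.
rewrite size_map map_inj_uniq // => /(_ us) <-.
congr rprob; apply/seteqP; split => x /=.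
  by move=> h _ /mapP[i si ->]; exact: h.
by move=> h i si; apply: (h (f i)); exact: map_f.
Qed.

Definition flip (i : I) (x : coins I) : coins I :=
  fun j => if j == i then ~~ x j else x j.

Lemma measurable_flip i : measurable_fun setT (flip i).
Proof.
apply: measurable_to_coins => j; rewrite /flip.
case: eqP => _; last exact: measurable_coin.
have -> : (fun x : coins I => ~~ x j : Prop) = ~` [set x : coins I | x j].
  by apply/seteqP; split => x /= /negP.
by apply: measurableC; exact: measurable_coin.
Qed.

Lemma coins_flip i A : measurable A -> P (flip i @^-1` A) = P A.
Proof.
apply: coins_preserved; first exact: measurable_flip.
move=> s us; have <- := @cylinderE _ (fun j => j != i) us; congr rprob.
apply/seteqP; split => x /= h j sj; have := h j sj; rewrite /flip;
  by case: eqP => //= _; case: (x j).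
Qed.

(** The flip exchanges the part of [A] where the coin is 1 with the part where
    it is 0, so they have the same probability. *)
Lemma flip_half i A : measurable A -> flip i @^-1` A = A ->
  rprob P (A `&` [set x | x i]) = rprob P A / 2.
Proof.
move=> mA fA; have mi := @measurable_coin I i.
have h : rprob P (A `&` [set x | x i]) = rprob P (A `\` [set x | x i]).
  have mD := measurableD mA mi.
  rewrite /rprob -(coins_flip i mD); congr (fine (P _)).
  have fAx x : A (flip i x) = A x by have := congr1 (@^~ x) fA.
  by apply/seteqP; split => x /=; rewrite fAx /flip eqxx; case: (x i) => -[].
by have := rprob_split P mA mi; lra.
Qed.

(** Iterating [flip_half]: an event that ignores the coins in [s] is independent
    of any event prescribing these coins. *)
Lemma flips_cylinder A s y : measurable A -> uniq s ->
  (forall i, i \in s -> flip i @^-1` A = A) ->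
  rprob P (A `&` cylinder s y) = rprob P A * weight (size s).
Proof.
move=> mA; elim: s => [|i s IH] /=.
  have -> : cylinder [::] y = setT by apply/seteqP; split.
  by rewrite setIT /weight expr0 mulr1.
move=> /andP[nsi us] fA.
have mB : measurable (A `&` cylinder s y).
  by apply: measurableI => //; exact: measurable_cylinder.
have fB : flip i @^-1` (A `&` cylinder s y) = A `&` cylinder s y.
  rewrite preimage_setI fA ?inE ?eqxx //; congr (_ `&` _).
  apply/seteqP; split => x /= h j sj; have := h j sj; rewrite /flip;
    by case: eqP => // ij; rewrite -ij sj in nsi.
have half := flip_half mB fB; have mi := @measurable_coin I i.
have eB : rprob P (A `&` cylinder s y) = rprob P A * weight (size s).
  by apply: IH => // j sj; apply: fA; rewrite inE sj orbT.
have split_B := rprob_split P mB mi.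
rewrite eB (weightS (R := R)) in half split_B.
case yi : (y i).
  have -> : A `&` cylinder (i :: s) y = A `&` cylinder s y `&` [set x | x i].
    apply/seteqP; split => x /=.
      move=> [Ax h]; split; last by rewrite h // inE eqxx.
      by split => // j sj; apply: h; rewrite inE sj orbT.
    move=> [[Ax h] xi]; split => // j; rewrite inE => /orP[/eqP->|]; last exact: h.
    by rewrite xi.
  by rewrite half; lra.
have -> : A `&` cylinder (i :: s) y = A `&` cylinder s y `\` [set x | x i].
  apply/seteqP; split => x /=.
    move=> [Ax h]; split; last by rewrite h ?yi // inE eqxx.
    by split => // j sj; apply: h; rewrite inE sj orbT.
  move=> [[Ax h] xi]; split => // j; rewrite inE => /orP[/eqP->|]; last exact: h.
  by rewrite yi; apply/negbTE/negP.
by rewrite half in split_B; lra.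
Qed.
End CoinCylinders.

(** * Ergodicity of the shift of the coins *)

Section CoinErgodicity.
Set Implicit Arguments. Unset Strict Implicit.
Context (R : realType) (I : countType).
Local Notation P := (fair_coins R I).
Local Notation weight := (@weight R).

Definition local_on (s : seq I) (B : set (coins I)) : Prop :=
  forall x y : coins I, {in s, x =1 y} -> B x -> B y.

Definition approximable (A : set (coins I)) : Prop :=
  forall e : R, 0 < e -> exists s B, local_on s B /\ rprob P (A `+` B) < e.

Lemma approximableC A : approximable A -> approximable (~` A).
Proof.
move=> aA e e0; have [s [B [lB h]]] := aA e e0; exists s, (~` B); split.
  move=> x y xy nBx By; apply: nBx; apply: lB By => i si.
  by rewrite xy.
congr (_ < _): h; congr rprob; apply/seteqP; split => x; rewrite /setY /=;
  have [Bx|nBx] := pselect (B x); have [Ax|nAx] := pselect (A x); tauto.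
Qed.

Lemma approximableU A B : measurable A -> measurable B ->
  approximable A -> approximable B -> approximable (A `|` B).
Proof.
move=> mA mB aA aB e e0; have e2 : 0 < e / 2 by lra.
have [s [C [lC hC]]] := aA _ e2; have [t [D [lD hD]]] := aB _ e2.
have mC := measurable_coins_local lC; have mD := measurable_coins_local lD.
exists (s ++ t), (C `|` D); split.
  move=> x y xy [Cx|Dx]; [left; apply: lC Cx|right; apply: lD Dx] => i si;
    by apply: xy; rewrite mem_cat si ?orbT.
have mAC := measurable_setY mA mC; have mBD := measurable_setY mB mD.
apply: (@le_lt_trans _ _ (rprob P (A `+` C) + rprob P (B `+` D))); last by lra.
apply: le_trans (rprobU_le P mAC mBD); apply: le_rprob.
- by apply: measurable_setY; exact: measurableU.
- exact: measurableU.
- by move=> x; rewrite /setY /=; tauto.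
Qed.

(** Events that can be approximated by events on finitely many coins form a
    sigma-algebra. For a countable union, a finite one already captures all but
    a small part of the probability. *)
Lemma coins_approximable A : measurable A -> approximable A.
Proof.
move=> mA; suff [] : measurable A /\ approximable A by [].
suff : measurable `<=` [set A : set (coins I) | measurable A /\ approximable A].
  exact.
apply: smallest_sub; last first.
  move=> _ [i ->]; split; first exact: measurable_coin.
  move=> e e0; exists [:: i], [set x | x i]; split.
    by move=> x y xy /=; rewrite xy // inE.
  by rewrite setYK rprob0.
split.
- split; first exact: measurable0.
  by move=> e e0; exists [::], set0; rewrite setYK rprob0; split.
- move=> B [mB aB]; rewrite setTD; split; first exact: measurableC.
  exact: approximableC.
- suff H (F : nat -> set (coins I)) :
      (forall n, measurable (F n) /\ approximable (F n)) ->
      measurable (\bigcup_n F n) /\ approximable (\bigcup_n F n) by exact: H.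
  move=> mF; split; first by apply: bigcup_measurable => n _; case: (mF n).
  pose G n : set (coins I) := \bigcup_(i in `I_n) F i.
  have GS n : G n.+1 = G n `|` F n by rewrite /G IIS bigcup_setU bigcup_set1.
  have mG n : measurable (G n).
    by apply: fin_bigcup_measurable => // i _; case: (mF i).
  have aG n : approximable (G n).
    elim: n => [|n IH].
      rewrite /G II0 bigcup_set0 => e e0.
      by exists [::], set0; rewrite setYK rprob0; split.
    by rewrite GS; case: (mF n) => mFn aFn; exact: approximableU.
  have ndG : nondecreasing_seq G.
    move=> m n mn; apply/subsetPset => x [i /= im Fx]; exists i => //=.
    exact: leq_trans mn.
  have UG : \bigcup_n F n = \bigcup_n G n.
    apply/seteqP; split => x [n _].
      by move=> Fx; exists n.+1 => //; exists n => /=.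
    by move=> [i _ Fx]; exists i.
  have mU : measurable (\bigcup_n G n) by exact: bigcup_measurable.
  move=> e e0; have e2 : 0 < e / 2 by lra.
  have [n hn] := rprob_bigcup_near P e2 mG ndG.
  have [s [B [lB hB]]] := aG n _ e2; exists s, B; split => //.
  have mB := measurable_coins_local lB.
  rewrite UG; apply: le_lt_trans (rprob_setY_tri P mU (mG n) mB) _.
  suff : rprob P ((\bigcup_n G n) `+` G n) < e / 2 by lra.
  have GU : G n `<=` \bigcup_n G n by exact: bigcup_sup.
  have := rprob_split P mU (mG n); rewrite setIidr // => E.
  have -> : (\bigcup_n G n) `+` G n = (\bigcup_n G n) `\` G n.
    apply/seteqP; split => x; first by case=> // -[/GU].
    by left.
  by lra.
Qed.

(** Let [A] be invariant and [C] a cylinder. Approximate [A] by an event [B] on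
    finitely many coins, and move [C] by an iterate of [f] to coins that [B]
    ignores: [B] is independent of the moved cylinder, while [A] does not notice
    the move. Hence [A] is independent of every cylinder, thus of itself. *)
Lemma coins_ergodic (f : I -> I) (A : set (coins I)) : injective f ->
  (forall s t : seq I, exists n, forall i, i \in t -> iter n f i \notin s) ->
  measurable A -> reindex f @^-1` A = A -> P A = 0%E \/ P A = 1%E.
Proof.
move=> finj wander mA invA.
have invn n : reindex (iter n f) @^-1` A = A.
  elim: n => [//|n IH]; rewrite -[RHS]IH -[in RHS]invA.
  apply/seteqP; split => x /=; congr A; apply/funext => i;
  by rewrite /reindex -iterSr.
have injn n : injective (iter n f).
  by elim: n => [//|n IH] x y /= /finj /IH.
have indep t : uniq t ->
    rprob P (A `&` cylinder t xpredT) = rprob P A * weight (size t).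
  move=> ut; have mC := @measurable_cylinder I t xpredT.
  apply/eqP; rewrite -subr_eq0 -normr_le0; apply/ler_addgt0Pr => e e0.
  have e2 : 0 < e / 2 by lra.
  have [s [B [lB hB]]] := coins_approximable mA e2.
  have mB := measurable_coins_local lB.
  have [n hn] := wander s t.
  pose C' := cylinder (map (iter n f) t) xpredT : set (coins I).
  have mC' : measurable C' by exact: measurable_cylinder.
  have -> : rprob P (A `&` cylinder t xpredT) = rprob P (A `&` C').
    rewrite /rprob -(coins_reindex R (injn n) (measurableI _ _ mA mC)).
    rewrite preimage_setI invn; congr (fine (P (_ `&` _))).
    apply/seteqP; split => x /=.
      by move=> h _ /mapP[i ti ->]; exact: h.
    by move=> h i ti; apply: (h (iter n f i)); exact: map_f.
  have BC' : rprob P (B `&` C') = rprob P B * weight (size t).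
    rewrite -(size_map (iter n f)); apply: flips_cylinder => //.
      by rewrite map_inj_uniq.
    move=> _ /mapP[i ti ->]; apply/seteqP; split => x /=; apply: lB => j js;
    rewrite /flip; case: eqP => // ji; by have := hn i ti; rewrite -ji js.
  have h1 := rprob_distI P mA mB mC'.
  have := rprob_distI P mA mB (measurableT : measurable (setT : set (coins I))).
  rewrite !setIT => h2; rewrite BC' in h1.
  have w0 := weight_gt0 (R := R) (size t).
  have w1 : weight (size t) <= 1 by rewrite exprn_ile1 //; lra.
  move: h1 h2; rewrite !ler_norml => /andP[h11 h12] /andP[h21 h22].
  by rewrite add0r; apply/andP; split; nra.
pose c : {nonneg R} := NngNum (rprob_ge0 P A).
have AA : P (A `&` A) = (c%:num%:E * P A)%E.
  apply: (@coins_measure_unique R I (mrestr P mA) (mscale c P)) => //.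
    apply: le_lt_trans (ltry 1); apply: (@probability_le1 _ _ _ P (setT `&` A)).
    exact: measurableI.
  move=> s us; have mC := @measurable_cylinder I s xpredT.
  change (P (cylinder s xpredT `&` A) = c%:num%:E * P (cylinder s xpredT))%E.
  rewrite setIC (rprobE P (measurableI _ _ mA mC)).
  by rewrite indep // (rprobE P mC) cylinderE.
rewrite setIid (rprobE P mA) -EFinM /= in AA; case: AA => /eqP.
rewrite -subr_eq0 -{1}[rprob P A]mulr1 -mulrBr mulf_eq0 subr_eq0.
by rewrite (rprobE P mA) => /orP[/eqP->|/eqP<-]; [left|right].
Qed.
End CoinErgodicity.

(** * The renewal process *)

Section RenewalProcess.
Set Implicit Arguments. Unset Strict Implicit.

(** Two coins at each time: [(n, true)] has to be heads for a 1 to occur at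
    time [n], and [(n, false)] is tossed to settle it when the age is outside the
    prescribed set. *)
Definition clock : countType := (int * bool)%type.

Section Automaton.
Context (D : pred nat).
Implicit Types (x : coins clock) (n : int) (k a : nat).

(** The age after the next symbol. [None] means that the age is unknown, which
    happens only on a null set; as it counts as an age outside [D], the
    transition rule holds everywhere and not just almost everywhere. *)
Definition step (c e : bool) (s : option nat) : option nat :=
  if c && (e || oapp D false s) then Some 0%N else omap S s.

(** [run k n x] computes the age at time [n] from the last [k] pairs of coins
    only, starting from an unknown age. *)
Fixpoint run k n x : option nat :=
  if k is k'.+1 then step (x (n, true)) (x (n, false)) (run k' (n - 1) x)
  else None.

(** Once the age is known it does not depend on how far back the computation
    starts, because the age becomes known only through two heads, which
    overrule the previous state. *)
Lemma run_leq k k' n x a : (k <= k')%N -> run k n x = Some a ->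
  run k' n x = Some a.
Proof.
elim: k k' n a => [//|k IH] [//|k'] n a /=; rewrite ltnS => kk'.
case E: (run k (n - 1) x) => [b|]; first by rewrite (IH _ _ _ kk' E).
by rewrite /step /= orbF; case: (x (n, true)) => //=; case: (x (n, false)).
Qed.

Lemma run_local k n x y :
  (forall m b, n - k%:Z < m <= n -> x (m, b) = y (m, b)) ->
  run k n x = run k n y.
Proof.
elim: k n => [//|k IH] n xy /=; rewrite (IH (n - 1)).
  by rewrite !xy //; lia.
by move=> m b mn; apply: xy; lia.
Qed.

Definition age n x : option nat :=
  if pselect (exists a k, run k n x = Some a) is left e then Some (projT1 (cid e))
  else None.

Lemma ageP n x a : age n x = Some a <-> exists k, run k n x = Some a.
Proof.
rewrite /age; case: pselect => [e|ne]; last by split=> // h; case: ne; exists a.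
case: (cid e) => b [k Hk] /=; split => [[<-]|[k' Hk']]; first by exists k.
have := run_leq (leq_maxl k k') Hk.
by rewrite (run_leq (leq_maxr k k') Hk') => -[->].
Qed.

Lemma age_run k n x a : run k n x = Some a -> age n x = Some a.
Proof. by move=> h; apply/ageP; exists k. Qed.

Lemma age_step n x :
  age n x = step (x (n, true)) (x (n, false)) (age (n - 1) x).
Proof.
case E: (age (n - 1) x) => [a|].
  move/ageP: E => [k Hk].
  case F: step => [b|]; last by move: F; rewrite /step; case: ifP.
  by apply: (@age_run k.+1); rewrite /= Hk.
have N k : run k (n - 1) x = None.
  by case H: run => [b|] //; rewrite (age_run H) in E.
case F: step => [a|]; first by apply: (@age_run 1) => /=; rewrite F.
case G: age => [a|] //; move/ageP: G => [[//|k] /=].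
by rewrite N F.
Qed.

Definition renewal n x : bool := age n x == Some 0%N.

Lemma renewalE n x :
  renewal n x = x (n, true) && (x (n, false) || oapp D false (age (n - 1) x)).
Proof.
by rewrite /renewal age_step /step; case: ifP => // _; case: (age (n - 1) x).
Qed.

(** This makes the age, which is computed from the coins, a function of the path. *)
Lemma age_renewalF n x : renewal n x = false ->
  age n x = omap S (age (n - 1) x).
Proof. by rewrite renewalE => h; rewrite age_step /step h. Qed.

Lemma age_renewal n x a : age n x = Some a <->
  renewal (n - a%:Z) x /\ (forall i, (i < a)%N -> renewal (n - i%:Z) x = false).
Proof.
elim: a n => [|a IH] n.
  by rewrite subr0 /renewal; split => [->|[/eqP]].
have shiftE i : n - 1 - i%:Z = n - (i.+1)%:Z by lia.
split.
  move=> nE; have R0 : renewal n x = false by rewrite /renewal nE.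
  have : age (n - 1) x = Some a.
    by move: nE; rewrite age_renewalF //; case: age => //= b [->].
  rewrite IH shiftE => -[-> h]; split => // -[_|i]; first by rewrite subr0.
  by rewrite ltnS -shiftE; exact: h.
move=> [h1 h2]; rewrite age_renewalF; last by have := h2 0%N; rewrite subr0; exact.
suff -> : age (n - 1) x = Some a by [].
by apply/IH; rewrite shiftE; split => // i ia; rewrite shiftE h2.
Qed.

Lemma renewal_past n x y : (forall m b, m <= n -> x (m, b) = y (m, b)) ->
  renewal n x = renewal n y.
Proof.
move=> xy; have rE k : run k n x = run k n y.
  by apply: run_local => m b mn; apply: xy; lia.
suff E z z' : (forall k, run k n z = run k n z') -> renewal n z -> renewal n z'.
  by apply/idP/idP; apply: E => k; rewrite rE.
by move=> zz' /eqP/ageP[k]; rewrite zz' => h; apply/eqP/(age_run h).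
Qed.

Definition clock_shift (m : int) (p : clock) : clock := (p.1 + m, p.2).

Lemma clock_shift_inj m : injective (clock_shift m).
Proof. by move=> [a b] [c d] [/addIr -> ->]. Qed.

Lemma clock_shift_wanders (s t : seq clock) :
  exists n : nat, forall i, i \in t -> iter n (clock_shift 1) i \notin s.
Proof.
exists (\max_(i <- s) `|i.1| + \max_(i <- t) `|i.1|).+1%N.
move=> i it; apply/negP => js; set n := (_.+1) in js.
have iterE m : iter m (clock_shift 1) i = (i.1 + m%:Z, i.2).
  elim: m => [|m /= ->]; first by rewrite addr0; case: i {it js}.
  by rewrite /clock_shift /=; congr pair; lia.
have h1 := leq_bigmax_seq (P := xpredT) (F := fun i : clock => `|i.1|%N) _ it isT.
have := leq_bigmax_seq (P := xpredT) (F := fun i : clock => `|i.1|%N) _ js isT.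
by rewrite iterE /= /n; move: h1 => /=; lia.
Qed.

Lemma run_shift m k n x :
  run k n (reindex (clock_shift m) x) = run k (n + m) x.
Proof.
elim: k n => [//|k IH] n /=; rewrite IH /reindex /clock_shift /=.
by rewrite (_ : n - 1 + m = n + m - 1) //; lia.
Qed.

Lemma renewal_shift m n x :
  renewal n (reindex (clock_shift m) x) = renewal (n + m) x.
Proof.
apply/eqP/eqP => /ageP[k].
  by rewrite run_shift => h; exact: age_run h.
by rewrite -run_shift => h; exact: age_run h.
Qed.

Lemma measurable_run k n (s : option nat) :
  measurable [set x : coins clock | run k n x = s].
Proof.
apply: (@measurable_coins_local clock
  [seq (n - i%:Z, b) | i <- iota 0 k, b <- [:: true; false]]).
move=> x y xy /= <-; apply/esym/run_local => m b mn; apply: xy.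
apply/allpairsP; exists (`|n - m|%N, b) => /=; split.
- by rewrite mem_iota; lia.
- by case: b; rewrite !inE.
- by congr pair; lia.
Qed.

Lemma measurable_renewal n : measurable [set x : coins clock | renewal n x].
Proof.
have -> : [set x : coins clock | renewal n x] =
    \bigcup_k [set x | run k n x = Some 0%N].
  apply/seteqP; split => x /=; first by move=> /eqP/ageP[k h]; exists k.
  by move=> [k _ h]; apply/eqP/(age_run h).
by apply: bigcup_measurable => k _; exact: measurable_run.
Qed.

Lemma measurable_fun_renewal n :
  @measurable_fun _ _ (coins clock) bool setT (renewal n).
Proof.
apply: (measurable_fun_bool true); rewrite setTI.
exact: measurable_renewal.
Qed.

Context (R : realType).

Definition renewal_process n : {RV fair_coins R clock >-> bool} :=
  MeasurableFun.Pack (MeasurableFun.Class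
    (isMeasurableFun.Build _ _ (coins clock) bool (renewal n)
       (measurable_fun_renewal n))).

Local Notation P := (fair_coins R clock).
Local Notation X := renewal_process.

Lemma sample_path_shift m x :
  sample_path X (reindex (clock_shift m) x) = fun i => sample_path X x (i + m).
Proof. by apply/funext => i; exact: renewal_shift. Qed.

Lemma measurable_block_event n w : measurable (block_event X n w).
Proof.
apply: (@measurable_local _ (coins clock) int
  (fun i x => renewal i x) [seq n + i%:Z | i <- iota 0 (size w)]
  (fun p => block p n (size w) = w) measurable_renewal).
move=> p q pq h; rewrite -[RHS]h /block /mkseq; apply/eq_in_map => i hi.
by apply/esym/pq; exact: map_f.
Qed.

Lemma renewal_stationary : stationary X.
Proof.
move=> n w; rewrite -(coins_reindex R (@clock_shift_inj n) (measurable_block_event 0 w)).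
congr (P _); apply/seteqP; split => x; rewrite /block_event /= => h;
  rewrite -[RHS]h /block /mkseq; apply/eq_map => i; by rewrite sample_path_shift add0r addrC.
Qed.

Lemma measurable_sample_path (A : set (int -> bool)) :
  path_measurable A -> measurable (sample_path X @^-1` A).
Proof.
suff : path_measurable `<=` [set A | measurable (sample_path X @^-1` A)].
  exact.
apply: smallest_sub; last first.
  move=> _ [i [b ->]]; case: b; first exact: measurable_renewal.
  have := measurableC (measurable_renewal i); congr measurable.
  apply/seteqP; split => x /=; first by move=> /negP/negbTE.
  by move=> h; apply/negP/negbT; exact: h.
split => [|B mB|F mF] /=.
- by rewrite preimage_set0; exact: measurable0.
- by rewrite setTD preimage_setC; exact: measurableC.
- by rewrite preimage_bigcup; apply: bigcup_measurable => k _; exact: mF.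
Qed.

Lemma renewal_ergodic : ergodic X.
Proof.
move=> A mA invA; apply: (@coins_ergodic R clock (clock_shift 1)).
- exact: clock_shift_inj.
- exact: clock_shift_wanders.
- exact: measurable_sample_path.
- rewrite -[RHS](congr1 (fun B => sample_path X @^-1` B) invA).
  by apply/seteqP; split => x /=; rewrite sample_path_shift.
Qed.
End Automaton.
End RenewalProcess.

(** * Conditional probabilities and memory of the renewal process *)

Section RenewalMemory.
Set Implicit Arguments. Unset Strict Implicit.
Context (R : realType).
Local Notation P := (fair_coins R clock).

Section OneProcess.
Context (D : pred nat).
Local Notation X := (@renewal_process D R).
Local Notation age := (@age D).
Local Notation renewal := (@renewal D).
Local Notation run := (@run D).
Local Notation hit s := (oapp D false s).

Definition rate (b : bool) : R := if b then 2^-1 else 4^-1.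

Lemma coins_invariant_past (A : set (coins clock)) n m b :
  (forall x y : coins clock, (forall m' b', m' < n -> x (m', b') = y (m', b')) ->
     A x -> A y) -> n <= m ->
  flip (m, b) @^-1` A = A.
Proof.
move=> pastA nm; apply/seteqP; split => x; apply: pastA => m' b' m'n;
  by rewrite /flip; case: eqP => // -[E]; lia.
Qed.

Lemma flip_coin_other (i j : clock) : j != i ->
  flip i @^-1` [set x : coins clock | x j] = [set x : coins clock | x j].
Proof. by move=> /negbTE ji; apply/seteqP; split => x /=; rewrite /flip ji. Qed.

(** The coins of time [n] are unaffected by the past event [A]; on [A] the symbol
    1 requires the first coin when the age is in [D], and both coins otherwise. *)
Lemma renewal_rate (A : set (coins clock)) n b : measurable A ->
  (forall x y : coins clock, (forall m b', m < n -> x (m, b') = y (m, b')) ->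
     A x -> A y) ->
  (forall x, A x -> hit (age (n - 1) x) = b) ->
  rprob P (A `&` [set x | renewal n x]) = rprob P A * rate b.
Proof.
move=> mA pastA hitA.
have fA b' : flip (n, b') @^-1` A = A := coins_invariant_past b' pastA (lexx n).
have hc := flip_half R mA (fA true).
have mc := @measurable_coin clock (n, true).
case: b hitA => hitA /=.
  rewrite -hc; congr rprob.
  by apply/seteqP; split => x /= [Ax]; rewrite renewalE hitA // orbT andbT.
have mAc := measurableI _ _ mA mc.
have fAc : flip (n, false) @^-1` (A `&` [set x | x (n, true)]) =
    A `&` [set x | x (n, true)].
  by rewrite preimage_setI fA flip_coin_other // xpair_eqE andbF.
have := flip_half R mAc fAc; rewrite hc => h.
have -> : A `&` [set x | renewal n x] =
    A `&` [set x | x (n, true)] `&` [set x | x (n, false)].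
  apply/seteqP; split => x /=.
    by move=> [Ax]; rewrite renewalE hitA // orbF => /andP[].
  by move=> [[Ax h1 h2]]; split => //; rewrite renewalE h1 h2.
by rewrite h; lra.
Qed.

Lemma block_eventP n w x : block_event X n w x <->
  forall i, (i < size w)%N -> renewal (n + i%:Z) x = nth false w i.
Proof.
rewrite /block_event /=; split => [<- i|h].
  by rewrite size_mkseq => iw; rewrite nth_mkseq.
apply: (@eq_from_nth _ false); rewrite size_mkseq // => i iw.
by rewrite nth_mkseq // -h.
Qed.

Lemma word_probE w : word_prob X w = rprob P (block_event X 0 w).
Proof. by []. Qed.

Lemma block_event_rcons w y : block_event X 0 (rcons w y) =
  block_event X 0 w `&` [set x | renewal (size w)%:Z x = y].
Proof.
apply/seteqP; split => x.
  move=> /block_eventP; rewrite size_rcons => h; split.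
    by apply/block_eventP => i iw; rewrite h ?nth_rcons ?iw // ltnW.
  by rewrite /= -[(size w)%:Z]add0r h // nth_rcons ltnn eqxx.
move=> [/block_eventP h /= hy]; apply/block_eventP => i.
rewrite size_rcons ltnS leq_eqVlt nth_rcons => /orP[/eqP->|iw].
  by rewrite ltnn eqxx add0r.
by rewrite iw h.
Qed.

Lemma word_prob_rcons w b :
  (forall x, block_event X 0 w x -> hit (age ((size w)%:Z - 1) x) = b) ->
  word_prob X (rcons w true) = word_prob X w * rate b /\
  word_prob X (rcons w false) = word_prob X w * (1 - rate b).
Proof.
move=> hw; have mw := measurable_block_event D R 0 w.
have mr := @measurable_renewal D (size w)%:Z.
have past x y : (forall m b', m < (size w)%:Z -> x (m, b') = y (m, b')) ->
    block_event X 0 w x -> block_event X 0 w y.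
  move=> xy /block_eventP h; apply/block_eventP => i iw; rewrite -h //.
  by apply/esym/renewal_past => m b' mi; apply: xy; lia.
have h1 := renewal_rate mw past hw.
have h2 := rprob_split P mw mr; rewrite h1 in h2.
rewrite !word_probE !block_event_rcons; split; first exact: h1.
have -> : block_event X 0 w `&` [set x | renewal (size w)%:Z x = false] =
    block_event X 0 w `\` [set x | renewal (size w)%:Z x].
  apply/seteqP; split => x /= [hx hr]; split => //; first by rewrite hr.
  exact/negbTE/negP.
by lra.
Qed.

Lemma cond_prob_rate w b y : 0 < word_prob X w ->
  (forall x, block_event X 0 w x -> hit (age ((size w)%:Z - 1) x) = b) ->
  cond_prob X w y = if y then rate b else 1 - rate b.
Proof.
move=> w0 /word_prob_rcons[h1 h2]; rewrite /cond_prob.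
by case: y; rewrite ?h1 ?h2 mulrAC divff ?mul1r ?gt_eqF.
Qed.

Lemma word_prob_gt0_suffix z w : 0 < word_prob X (z ++ w) -> 0 < word_prob X w.
Proof.
move=> h; apply: (lt_le_trans h).
have -> : word_prob X w = rprob P (block_event X (size z)%:Z w).
  by rewrite /rprob (renewal_stationary D R (size z)%:Z w).
apply: le_rprob; [exact: measurable_block_event|exact: measurable_block_event|].
move=> x /block_eventP hx; apply/block_eventP => i iw.
have := hx (size z + i)%N; rewrite size_cat ltn_add2l iw => /(_ isT).
rewrite nth_cat ltnNge leq_addr /= addKn => <-.
by rewrite add0r PoszD.
Qed.

Lemma word_prob_gt0_prefix w y : 0 < word_prob X (rcons w y) -> 0 < word_prob X w.
Proof.
move=> h; apply: (lt_le_trans h); apply: le_rprob.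
- exact: measurable_block_event.
- exact: measurable_block_event.
- by rewrite block_event_rcons; exact: subIsetl.
Qed.

(** Both the order of a chain and the memory length quantify over the words
    that may precede [w]. This is a condition on the paths which yields the
    corresponding equalities of conditional probabilities. *)
Definition settles (w : seq bool) (b : bool) : Prop :=
  forall z x, block_event X 0 (z ++ w) x ->
    hit (age ((size (z ++ w))%:Z - 1) x) = b.

Lemma settles_cond_prob w b z y : settles w b -> 0 < word_prob X (z ++ w) ->
  cond_prob X (z ++ w) y = cond_prob X w y.
Proof.
move=> sw zw0; rewrite (cond_prob_rate y zw0 (sw z)).
have w0 := word_prob_gt0_suffix zw0.
by rewrite (cond_prob_rate y w0 (sw [::])).
Qed.

Lemma settles_is_memory x m k b : settles (last_block x m k) b ->
  is_memory X x m k.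
Proof.
move=> sw z y _ /word_prob_gt0_prefix h.
by rewrite (settles_cond_prob y sw h).
Qed.

Lemma settles_one a u : settles (u ++ true :: nseq a false) (D a).
Proof.
move=> z x; rewrite catA; move: (z ++ u) => v /block_eventP h.
suff -> : age ((size (v ++ true :: nseq a false))%:Z - 1) x = Some a by [].
apply/age_renewal; move: h; rewrite size_cat /= size_nseq => h; split.
  have := h (size v); rewrite nth_cat ltnn subnn /= => h0.
  by apply: etrans (h0 _); [congr (renewal _ x)|]; lia.
move=> i ia; have := h (size v + (a - i.+1).+1)%N.
have nlt : (size v + (a - i.+1).+1 < size v)%N = false by lia.
rewrite nth_cat nlt addKn.
rewrite /= nth_nseq if_same => h0.
by apply: etrans (h0 _); [congr (renewal _ x)|]; lia.
Qed.

(** The age after [k] zeros is unknown or at least [k], in either case outside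
    [D]. *)
Lemma settles_zeros k : (forall a, D a -> (a < k)%N) -> settles (nseq k false) false.
Proof.
move=> Dk z x /block_eventP; rewrite size_cat size_nseq => h.
case E: (age _ x) => [a|] //=; apply/negbTE/negP => /Dk ak.
move/age_renewal: E => [+ _].
have nlt : (size z + (k - a.+1) < size z)%N = false by lia.
have := h (size z + (k - a.+1))%N; rewrite nth_cat nlt addKn.
rewrite nth_nseq if_same (_ : 0 + _ = (size z + k)%N%:Z - 1 - a%:Z); last by lia.
by move=> -> //; lia.
Qed.

Lemma word_cases (w : seq bool) :
  (exists u a, w = u ++ true :: nseq a false) \/ w = nseq (size w) false.
Proof.
elim/last_ind: w => [|w [] IH]; first by right.
  by left; exists w, 0%N; rewrite cats1.
have nseqS a : rcons (nseq a false) false = nseq a.+1 false.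
  by elim: a => //= a ->.
case: IH => [[u [a ->]]|->].
  by left; exists u, a.+1; rewrite rcons_cat rcons_cons nseqS.
by right; rewrite nseqS size_nseq.
Qed.

Lemma renewal_markov k : (forall a, D a -> (a < k)%N) -> markov_order X k.
Proof.
move=> Dk z w y wk; case: (word_cases w) => [[u [a ->]]|w0].
  exact/settles_cond_prob/settles_one.
by rewrite w0 wk; exact/settles_cond_prob/settles_zeros.
Qed.

Lemma memory_length_le x m k : is_memory X x m k ->
  exists2 k', memory_length X x m = Some k' & (k' <= k)%N.
Proof.
move=> mk; rewrite /memory_length; case: pselect => [e|]; last first.
  by case; exists k; apply/asboolP.
by case: ex_minnP => k' _ /(_ k (asboolT mk)) kk'; exists k'.
Qed.

Lemma memory_length_gt x m k k' : memory_length X x m = Some k' ->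
  (forall j, (j <= k)%N -> ~ is_memory X x m j) -> (k < k')%N.
Proof.
rewrite /memory_length; case: pselect => // e [<-] h.
case: ex_minnP => j /asboolP mj _; rewrite ltnNge; apply/negP => jk.
exact: h mj.
Qed.

Lemma last_blockE x m k : last_block x m k = nseq k false <->
  forall i, (i < k)%N -> x (m - i%:Z) = false.
Proof.
split=> h.
  move=> i ik; have := congr1 (nth false ^~ (k - i.+1)%N) h.
  rewrite /= /last_block /block nth_mkseq ?nth_nseq ?if_same; last by lia.
  by rewrite (_ : _ + _ = m - i%:Z) //; lia.
apply: (@eq_from_nth _ false); rewrite size_mkseq ?size_nseq // => i ik.
rewrite nth_mkseq // nth_nseq if_same -(h (k - i.+1)%N); last by lia.
by congr x; lia.
Qed.

(** Two heads followed by tails at all later times force this word. *)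
Lemma word_prob_one_zeros a : 0 < word_prob X (true :: nseq a false).
Proof.
pose s : seq clock := (0, false) :: [seq (i%:Z, true) | i <- iota 0 a.+1].
have us : uniq s.
  rewrite cons_uniq map_inj_uniq; last by move=> i j [].
  by rewrite iota_uniq andbT; apply/mapP => -[].
pose y (p : clock) := p.1 == 0.
have := cylinderE R y us => h.
apply: (@lt_le_trans _ _ (rprob P (cylinder s y))); first by rewrite h weight_gt0.
apply: le_rprob; first exact: measurable_cylinder.
  exact: measurable_block_event.
move=> x hx; apply/block_eventP => -[_|i] /=.
  by rewrite addr0 renewalE !hx // !inE ?eqxx ?orbT.
rewrite size_nseq ltnS nth_nseq if_same => ia.
rewrite renewalE hx /y /= ?add0r // inE; apply/orP; right.
by apply/mapP; exists i.+1 => //; rewrite mem_iota.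
Qed.

(** Preceding [0^k] by [1 0^(i-k)] makes the age [i]; two such extensions, with
    ages inside and outside [D], have different rates, and the rate of [0^k]
    cannot equal both. *)
Lemma zeros_not_memory x m k : last_block x m k = nseq k false ->
  (exists2 i, (k <= i)%N & D i) -> (exists2 i, (k <= i)%N & ~~ D i) ->
  ~ is_memory X x m k.
Proof.
move=> E [i ki Di] [j kj Dj] mem.
suff rate_eq a : (k <= a)%N -> cond_prob X (nseq k false) true = rate (D a).
  have := rate_eq i ki; rewrite (rate_eq j kj) Di (negbTE Dj) /rate; lra.
move=> ka; have sz := @settles_one a [::].
have wE : (true :: nseq (a - k) false) ++ nseq k false = true :: nseq a false.
  by rewrite /= -nseqD subnK.
have w0 := word_prob_one_zeros a.
have rw := cond_prob_rate true w0 (sz [::]).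
move: mem; rewrite /is_memory E => /(_ (true :: nseq (a - k) false) true isT).
rewrite wE rw; apply.
have [-> _] := word_prob_rcons (sz [::]).
by rewrite mulr_gt0 //; rewrite /rate; case: ifP => _; lra.
Qed.

(** The age remains unknown only as long as no two heads occur. *)
Lemma run_none_le k n : rprob P [set x | run k n x = None] <= (3 / 4) ^+ k.
Proof.
elim: k n => [|k IH] n; first by rewrite expr0 rprob_le1 //; exact: measurable_run.
pose B := [set x : coins clock | run k (n - 1) x = None].
have mB : measurable B by exact: measurable_run.
have fB b : flip (n, b) @^-1` B = B.
  apply: (@coins_invariant_past B n) => // x y xy; rewrite /B /= => <-.
  by apply/esym/run_local => m b' mn; apply: xy; lia.
have mc := @measurable_coin clock (n, true).
have mBc := measurableI _ _ mB mc.
have fBc : flip (n, false) @^-1` (B `&` [set x | x (n, true)]) =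
    B `&` [set x | x (n, true)].
  by rewrite preimage_setI fB flip_coin_other // xpair_eqE andbF.
have h1 := flip_half R mB (fB true).
have h2 := flip_half R mBc fBc; rewrite h1 in h2.
pose C := [set x : coins clock | x (n, true)] `&` [set x | x (n, false)].
have mC : measurable C by apply: measurableI; exact: measurable_coin.
have h3 := rprob_split P mB mC; rewrite setIA in h3.
have h4 : rprob P [set x | run k.+1 n x = None] <= rprob P (B `\` C).
  apply: le_rprob; [exact: measurable_run|exact: measurableD|].
  move=> x /=; rewrite /B /C /= /step.
  case: ifP => // h; case: (run k (n - 1) x) => // _; split => // -[c e].
  by rewrite c e in h.
have h5 := IH (n - 1); rewrite -/B in h5.
by rewrite exprS; apply: (le_trans h4); rewrite h2 in h3; lra.
Qed.

(** When the age is known, the word from the last 1 on is a memory word. *)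
Lemma renewal_finitarily_markovian : finitarily_markovian X.
Proof.
have mN : measurable [set x : coins clock | age 0 x = None].
  have -> : [set x : coins clock | age 0 x = None] =
      \bigcap_k [set x | run k 0 x = None].
    apply/seteqP; split => x /=.
      move=> h k _ /=; case E: (run k 0 x) => [a|//].
      by rewrite (age_run E) in h.
    move=> h; case E: (age 0 x) => [a|//]; move/ageP: E => [k].
    by rewrite (h k I).
  by apply: bigcapT_measurable => k; exact: measurable_run.
exists [set x : coins clock | age 0 x = None]; split => //.
  rewrite (rprobE P mN); congr EFin; apply/eqP; rewrite eq_le rprob_ge0 andbT.
  apply/ler_addgt0Pr => e e0; rewrite add0r.
  have [k hk] : exists k, (3 / 4 : R) ^+ k < e.
    have := @cvg_expr R (3 / 4); rewrite ger0_norm ?divr_ge0 //.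
    move=> /(_ _)/cvgrPdist_lt/(_ _ e0)[]; first by lra.
    move=> k _ /(_ k (leqnn k)); rewrite /= sub0r normrN ger0_norm ?exprn_ge0 ?divr_ge0 //.
    by exists k.
  apply: (le_trans _ (ltW hk)); apply: (le_trans _ (run_none_le k 0)).
  apply: le_rprob => //; first exact: measurable_run.
  move=> x /= h; case E: (run k 0 x) => [a|//].
  by rewrite (age_run E) in h.
move=> x /= /contrapT; case E: (age 0 x) => [a|//].
suff /memory_length_le[k' -> _] : is_memory X (sample_path X x) 0 a.+1 by [].
apply: (@settles_is_memory _ _ _ (D a)).
suff -> : last_block (sample_path X x) 0 a.+1 = true :: nseq a false.
  exact: (@settles_one a [::]).
move/age_renewal: E => [h1 h2]; rewrite /last_block /block.
apply: (@eq_from_nth _ false); rewrite size_mkseq /= ?size_nseq // => -[_|i].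
  by rewrite nth_mkseq //= -h1; congr (renewal _ x); lia.
rewrite ltnS => ia; rewrite nth_mkseq //= nth_nseq if_same.
by rewrite -(h2 (a - i.+1)%N); [congr (renewal _ x)|]; lia.
Qed.
End OneProcess.

Lemma run_lt D k n x a : @run D k n x = Some a -> (a < k)%N.
Proof.
elim: k n a => [//|k IH] n a /=; rewrite /step; case: ifP => [_ [<-]//|_].
by case E: run => [b|] //= [<-]; rewrite ltnS; exact: IH E.
Qed.

(** A computation from the last [L] pairs of coins only meets ages below [L]. *)
Lemma run_agree D D' L n x : (forall a, (a < L)%N -> D a = D' a) ->
  @run D L n x = @run D' L n x.
Proof.
move=> DD'; suff H k m : (k <= L)%N -> @run D k m x = @run D' k m x by exact: H.
elim: k m => [//|k IH] m kL /=; rewrite -IH; last exact: ltnW.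
rewrite /step; case E: run => [a|] //=; rewrite DD' //.
exact: leq_trans (run_lt E) (ltnW kL).
Qed.

Lemma renewal_agree D D' L n x : (forall a, (a < L)%N -> D a = D' a) ->
  @run D L n x != None -> @renewal D n x = @renewal D' n x.
Proof.
move=> DD'; case E: run => [a|] // _; have E' := E.
by rewrite (run_agree n x DD') in E'; rewrite /renewal (age_run E) (age_run E').
Qed.

Lemma renewal_agree_prob D D' L N : (forall a, (a < L)%N -> D a = D' a) ->
  exists B : set (coins clock), [/\ measurable B,
    rprob P B <= N.+1%:R * (3 / 4) ^+ L &
    forall x, ~ B x -> forall n, (n <= N)%N ->
      @renewal D n%:Z x = @renewal D' n%:Z x].
Proof.
move=> DD'; suff [B [mB hB h]] : exists B : set (coins clock), [/\ measurable B,
    rprob P B <= N.+1%:R * (3 / 4) ^+ L &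
    forall x n, (n <= N)%N -> @run D L n%:Z x = None -> B x].
  exists B; split => // x nBx n nN; apply: renewal_agree DD' _.
  by apply/eqP => E; apply: nBx; exact: h E.
elim: N => [|N [B [mB hB h]]].
  exists [set x | @run D L 0 x = None]; split; first exact: measurable_run.
    by rewrite mul1r; exact: run_none_le.
  by move=> x n; rewrite leqn0 => /eqP->.
exists (B `|` [set x | @run D L N.+1%:Z x = None]).
have mr := @measurable_run D L N.+1%:Z None; split; first exact: measurableU.
  apply: (le_trans (rprobU_le P mB mr)); rewrite -[N.+2%:R]natr1 mulrDl mul1r.
  by apply: lerD => //; exact: run_none_le.
move=> x n; rewrite leq_eqVlt => /orP[/eqP-> ?|nN E]; first by right.
by left; exact: h nN E.
Qed.
End RenewalMemory.

(** * Counting occurrences of events, and dense sequences of times *)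

Section Frequencies.
Set Implicit Arguments. Unset Strict Implicit.
Context {R : realType} {d : measure_display} {T : measurableType d}.
Context (P : probability T R).

(** Expected number of occurrences of the events [Z i] on [H], by induction on
    the list: splitting [H] along [Z i] leaves one occurrence fewer to count
    where [Z i] holds. *)
Lemma sum_rprob_le (I : eqType) (Z : I -> T -> bool) (s : seq I) (H : set T) (q : nat) :
  (forall i, measurable [set t | Z i t]) -> measurable H ->
  (forall t, H t -> (count (Z^~ t) s <= q)%N) ->
  \sum_(i <- s) rprob P (H `&` [set t | Z i t]) <= q%:R * rprob P H.
Proof.
move=> mZ; elim: s H q => [|i s IH] H q mH Hq.
  by rewrite big_nil mulr_ge0 // rprob_ge0.
have mHi := measurableI _ _ mH (mZ i); have mHD := measurableD mH (mZ i).
have hD : \sum_(j <- s) rprob P ((H `\` [set t | Z i t]) `&` [set t | Z j t]) <=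
    q%:R * rprob P (H `\` [set t | Z i t]).
  by apply: IH => // t [Ht _]; apply: leq_trans (Hq t Ht); rewrite /= leq_addl.
have hI : \sum_(j <- s) rprob P ((H `&` [set t | Z i t]) `&` [set t | Z j t]) +
    rprob P (H `&` [set t | Z i t]) <= q%:R * rprob P (H `&` [set t | Z i t]).
  case: q Hq {hD} => [|q] Hq.
    have -> : H `&` [set t | Z i t] = set0.
      apply/seteqP; split => // t [Ht Zt]; have := Hq t Ht.
      by move: Zt => /= ->.
    rewrite rprob0 addr0 mul0r big1 // => j _.
    by rewrite set0I rprob0.
  rewrite -natr1 mulrDl mul1r lerD2r; apply: IH => // t [Ht Zt].
  by have := Hq t Ht; move: Zt => /= ->; rewrite add1n ltnS.
have -> : rprob P H = rprob P (H `&` [set t | Z i t]) +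
    rprob P (H `\` [set t | Z i t]) by exact: rprob_split.
suff hs : \sum_(j <- s) rprob P (H `&` [set t | Z j t]) <=
    \sum_(j <- s) rprob P ((H `&` [set t | Z i t]) `&` [set t | Z j t]) +
    \sum_(j <- s) rprob P ((H `\` [set t | Z i t]) `&` [set t | Z j t]).
  by rewrite big_cons mulrDr; lra.
rewrite -big_split /=; apply: ler_sum => j _.
have mHj := measurableI _ _ mH (mZ j).
rewrite (rprob_split P mHj (mZ i)).
have -> : H `&` [set t | Z j t] `&` [set t | Z i t] =
    H `&` [set t | Z i t] `&` [set t | Z j t] by rewrite -!setIA (setIC [set t | Z j t]).
suff -> : H `&` [set t | Z j t] `\` [set t | Z i t] =
    (H `\` [set t | Z i t]) `&` [set t | Z j t] by [].
by apply/seteqP; split => t /=; tauto.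
Qed.

Lemma sum_rprob_split (I : eqType) (Z : I -> T -> bool) (s : seq I) (G : set T) (q : nat) :
  (forall i, measurable [set t | Z i t]) -> measurable G ->
  (forall t, ~ G t -> (count (Z^~ t) s <= q)%N) ->
  \sum_(i <- s) rprob P [set t | Z i t] <= (size s)%:R * rprob P G + q%:R.
Proof.
move=> mZ mG Gq; have mGC := measurableC mG.
have h1 : \sum_(i <- s) rprob P (G `&` [set t | Z i t]) <= (size s)%:R * rprob P G.
  by apply: sum_rprob_le => // t _; exact: count_size.
have h2 : \sum_(i <- s) rprob P (~` G `&` [set t | Z i t]) <= q%:R.
  apply: le_trans (sum_rprob_le mZ mGC Gq) _.
  by rewrite ler_piMr // rprob_le1.
apply: le_trans (lerD h1 h2); rewrite -big_split /=; apply: ler_sum => i _.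
rewrite (rprob_split P (mZ i) mG) setIC lerD2l.
by rewrite setDE setIC.
Qed.
End Frequencies.

Section DenseStoppingTimes.
Set Implicit Arguments. Unset Strict Implicit.

(** Suppose no [L n] with [n] large lies in [Z]. For suitable large [N], at
    least N/r of the times below [N] belong to [Z], so they leave room for only about (1 - 1/r) N
    values of [L]; thus the value of index about (1 - 1/r) N is already at least
    [N], which contradicts L n <= (1 + 1/r) n. *)
Lemma dense_times_hit (L : nat -> option nat) (Z : nat -> bool) (r : nat) :
  (forall n m', L n.+1 = Some m' -> exists2 m, L n = Some m & (m < m')%N) ->
  (forall r, (0 < r)%N -> exists n1, forall n, (n1 <= n)%N ->
     exists2 m, L n = Some m & (r * m <= r.+1 * n)%N) ->
  (forall M, exists2 N, (M <= N)%N & (N <= r * count Z (iota 0 N))%N) ->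
  forall n0, exists n m, [/\ (n0 <= n)%N, L n = Some m & Z m].
Proof.
move=> Linc Ldense Zfreq n0; apply: contrapT => noZ.
have r0 : (0 < r)%N by have [N N1] := Zfreq 1%N; case: (r) => //; lia.
have [n1 hn1] := Ldense r r0; pose k := maxn n0 n1.
have /choice[l hl] n : exists m, L (k + n)%N = Some m.
  have [|m] := hn1 (k + n)%N; first by rewrite /k; lia.
  by move=> h _; exists m.
have linc n m : (n < m)%N -> (l n < l m)%N.
  apply: (homo_ltn (f := l) ltn_trans) => i.
  have [|m' E] := Linc (k + i)%N (l i.+1); first by rewrite -addnS.
  by rewrite hl in E; case: E => ->.
have nZ n : ~~ Z (l n).
  apply/negP => Zl; apply: noZ; exists (k + n)%N, (l n); split => //.
  by rewrite /k; lia.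
(* the two bounds on [l (N - c)] combine to N <= r (r + 1) k *)
have [N hN Nc] := Zfreq (r * r.+1 * k).+1; set c := count Z _ in Nc.
have cN : (c <= N)%N by rewrite -[N in (_ <= N)%N](size_iota 0 N); exact: count_size.
have [m] := hn1 (k + (N - c))%N ltac:(rewrite /k; lia).
rewrite hl => -[<-{m}] hm.
have Nl : (N <= l (N - c))%N.
  rewrite leqNgt; apply/negP => lN.
  pose s := [seq l i | i <- iota 0 (N - c).+1].
  have us : uniq s.
    rewrite map_inj_uniq ?iota_uniq // => i j lij.
    by case: (ltngtP i j) => // /linc; rewrite lij ltnn.
  have /uniq_leq_size : {subset s <= [seq m <- iota 0 N | ~~ Z m]}.
    move=> _ /mapP[i hi ->]; rewrite mem_filter nZ mem_iota /=.
    apply: leq_ltn_trans lN; move: hi; rewrite mem_iota /= add0n ltnS leq_eqVlt.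
    by case/orP => [/eqP->//|/linc/ltnW].
  move=> /(_ us); rewrite size_map size_iota size_filter.
  have := count_predC Z (iota 0 N); rewrite size_iota -/c /=.
  by rewrite (eq_count (a2 := predC Z)) //; lia.
by nia.
Qed.
End DenseStoppingTimes.

(** * Zero blocks have positive upper density *)

Section ZeroBlocks.
Set Implicit Arguments. Unset Strict Implicit.
Context (R : realType) (D : pred nat) (k : nat).
Local Notation P := (fair_coins R clock).
Local Notation renewal := (@renewal D).

Definition zero_block (m : int) (x : coins clock) : bool :=
  all (fun i : nat => ~~ renewal (m - i%:Z) x) (iota 0 k).

Lemma zero_blockP m x :
  zero_block m x <-> forall i, (i < k)%N -> renewal (m - i%:Z) x = false.
Proof.
split=> [/allP h i ik|h]; first by apply/negbTE/h; rewrite mem_iota.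
by apply/allP => i; rewrite mem_iota => ik; rewrite h.
Qed.

Lemma measurable_zero_block m : measurable [set x : coins clock | zero_block m x].
Proof.
apply: (@measurable_local _ (coins clock) int (fun i x => renewal i x)
  [seq m - i%:Z | i <- iota 0 k]
  (fun p => all (fun i : nat => ~~ p (m - i%:Z)) (iota 0 k))
  (@measurable_renewal D)).
move=> p q pq /allP h; apply/allP => i ik; rewrite -pq; first exact: h.
exact: map_f.
Qed.

Lemma zero_block_shift s m x :
  zero_block m (reindex (clock_shift s) x) = zero_block (m + s) x.
Proof.
apply: eq_all => i; rewrite renewal_shift.
by rewrite (_ : m - i%:Z + s = m + s - i%:Z) //; lia.
Qed.

Lemma rprob_zero_block m :
  rprob P [set x | zero_block m x] = rprob P [set x | zero_block 0 x].
Proof.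
rewrite /rprob -(coins_reindex R (@clock_shift_inj m) (measurable_zero_block 0)).
congr (fine (P _)); apply/seteqP.
by split => x /=; rewrite zero_block_shift add0r.
Qed.

Lemma rprob_zero_block_gt0 : 0 < rprob P [set x | zero_block 0 x].
Proof.
pose s : seq clock := [seq (- i%:Z, true) | i <- iota 0 k].
have us : uniq s.
  by rewrite map_inj_uniq ?iota_uniq // => i j [] /oppr_inj[].
have h := cylinderE R (fun=> false) us.
apply: (@lt_le_trans _ _ (rprob P (cylinder s (fun=> false)))).
  by rewrite h weight_gt0.
apply: le_rprob; [exact: measurable_cylinder|exact: measurable_zero_block|].
move=> x hx /=; apply/zero_blockP => i ik; rewrite renewalE sub0r hx //.
by apply/mapP; exists i => //; rewrite mem_iota.
Qed.

Definition zero_count (N : nat) (x : coins clock) : nat :=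
  count (fun m : nat => zero_block m%:Z x) (iota 0 N).

(** Positive upper density of the ends of zero blocks. The bound 1/r is
    quantified inside the event to make it exactly shift-invariant. *)
Definition frequent_zeros : set (coins clock) :=
  [set x | exists r, forall M, exists2 N, (M <= N)%N &
     (N <= r * zero_count N x)%N].

Lemma measurable_zero_count r N :
  measurable [set x : coins clock | (N <= r * zero_count N x)%N].
Proof.
apply: (@measurable_local _ (coins clock) nat (fun m x => zero_block m%:Z x)
  (iota 0 N) (fun p => (N <= r * count p (iota 0 N))%N)).
  by move=> m; exact: measurable_zero_block.
by move=> p q pq; rewrite (eq_in_count pq).
Qed.

Lemma frequent_zerosE : frequent_zeros =
  \bigcup_r \bigcap_M \bigcup_N
    [set x | (M <= N)%N /\ (N <= r * zero_count N x)%N].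
Proof.
apply/seteqP; split => x.
  by move=> [r h]; exists r => // M _; have [N MN Nr] := h M; exists N.
by move=> [r _ h]; exists r => M; have [N _ [MN Nr]] := h M I; exists N.
Qed.

Lemma measurable_zero_count_after r M N :
  measurable [set x : coins clock | (M <= N)%N /\ (N <= r * zero_count N x)%N].
Proof.
have [MN|MN] := boolP (M <= N)%N.
  have -> : [set x : coins clock | true /\ (N <= r * zero_count N x)%N] =
      [set x : coins clock | (N <= r * zero_count N x)%N].
    by apply/seteqP; split => x //= -[].
  exact: measurable_zero_count.
have -> : [set x : coins clock | false /\ (N <= r * zero_count N x)%N] = set0.
  by apply/seteqP; split => x //= -[].
exact: measurable0.
Qed.

Lemma measurable_frequent_zeros : measurable frequent_zeros.
Proof.
rewrite frequent_zerosE; apply: bigcupT_measurable => r.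
apply: bigcapT_measurable => M; apply: bigcupT_measurable => N.
exact: measurable_zero_count_after.
Qed.

Lemma zero_count_shift N x :
  (zero_count N x <= (zero_count N (reindex (clock_shift 1) x)).+1)%N /\
  (zero_count N (reindex (clock_shift 1) x) <= (zero_count N x).+1)%N.
Proof.
pose Z (m : nat) := zero_block m%:Z x.
have -> : zero_count N (reindex (clock_shift 1) x) = count Z (iota 1 N).
  rewrite -[1%N]add0n addnC iotaDl count_map; apply: eq_count => m.
  by rewrite zero_block_shift /= /Z add1n -addn1.
have : (Z 0%N + count Z (iota 1 N) = count Z (iota 0 N) + Z N)%N.
  have -> : (Z 0%N + count Z (iota 1 N))%N = count Z (iota 0 N.+1) by [].
  by rewrite -[N.+1]addn1 iotaD count_cat /= addn0.
by rewrite /zero_count -/Z; case: (Z 0%N); case: (Z N) => /=; lia.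
Qed.

(** A shift changes the counts by at most 1, which doubling [r] absorbs. *)
Lemma frequent_zeros_shift :
  reindex (clock_shift 1) @^-1` frequent_zeros = frequent_zeros.
Proof.
have key x y : (forall N, (zero_count N x <= (zero_count N y).+1)%N) ->
    frequent_zeros x -> frequent_zeros y.
  move=> xy [r h]; exists (r + r)%N => M; have [N MN Nr] := h (M + r + r)%N.
  exists N; first by lia.
  have := leq_mul (leqnn r) (xy N); lia.
apply/seteqP; split => x /=; apply: key => N; by have [] := zero_count_shift N x.
Qed.

(** If [p] is the probability of a zero block, the count up to [N] has
    expectation [N p]. If r p >= 2, the count is therefore at least N / r with
    probability at least p / 2 for every positive [N], hence for infinitely many
    [N] with probability at least p / 2. Ergodicity raises this to 1. *)
Lemma frequent_zeros_ae : P frequent_zeros = 1%E.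
Proof.
have mF := measurable_frequent_zeros.
have [F0|//] : P frequent_zeros = 0%E \/ P frequent_zeros = 1%E.
  apply: (@coins_ergodic R clock (clock_shift 1)).
  - exact: clock_shift_inj.
  - exact: clock_shift_wanders.
  - exact: mF.
  - exact: frequent_zeros_shift.
exfalso; pose p := rprob P [set x | zero_block 0 x].
have p0 : 0 < p by exact: rprob_zero_block_gt0.
pose r := (Num.truncn (2 / p)).+1.
have rp : 2 <= r%:R * p.
  by rewrite -ler_pdivrMr // ltW // truncnS_gt.
pose G N := [set x : coins clock | (N <= r * zero_count N x)%N].
have mG N : measurable (G N) by exact: measurable_zero_count.
have Gp N : (0 < N)%N -> p / 2 <= rprob P (G N).
  move=> N0; have N0R : 0 < N%:R :> R by rewrite ltr0n.
  have : forall x, ~ G N x -> (zero_count N x <= N %/ r)%N.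
    move=> x /negP; rewrite -ltnNge => h.
    by rewrite leq_divRL // mulnC ltnW.
  move=> /(sum_rprob_split P (fun m => measurable_zero_block m%:Z) (mG N)).
  under eq_bigr do rewrite rprob_zero_block.
  rewrite big_const_seq count_predT size_iota iter_addr_0 -/p -mulr_natl => h.
  have hr : (N %/ r)%:R * r%:R <= N%:R :> R by rewrite -natrM ler_nat leq_trunc_div.
  have hq : 2 * (N %/ r)%:R <= N%:R * p.
    apply: le_trans (ler_wpM2r (ltW p0) hr).
    by rewrite -mulrA mulrC; apply: ler_wpM2l.
  by rewrite -(ler_pM2l N0R); lra.
pose U M := \bigcup_N [set x | (M <= N)%N /\ (N <= r * zero_count N x)%N] : set (coins clock).
have mU M : measurable (U M).
  by apply: bigcupT_measurable => N; exact: measurable_zero_count_after.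
have : p / 2 <= rprob P (\bigcap_M U M).
  apply: rprob_bigcap_ge => //.
    move=> M M' MM'; apply/subsetPset => x [N _ [MN Nr]]; exists N => //.
    by split => //; exact: leq_trans MN.
  move=> M; apply: (le_trans (Gp M.+1 isT)); apply: le_rprob => //.
  by move=> x Gx; exists M.+1 => //; split.
have : rprob P (\bigcap_M U M) <= rprob P frequent_zeros.
  apply: le_rprob => //; first exact: bigcapT_measurable.
  by move=> x Ux; rewrite frequent_zerosE; exists r.
have -> : rprob P frequent_zeros = 0 by rewrite /rprob F0.
lra.
Qed.
End ZeroBlocks.

(** * Low guesses on a finite-order renewal process *)

Section Stages.
Set Implicit Arguments. Unset Strict Implicit.
Context (R : realType).
Context (lam : nat -> (nat -> bool) -> option nat) (h : nat -> seq bool -> R).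
Context (lam_stop : forall n, stopping_time (lam n)).
Context (lam_incr : strictly_increasing_times lam).
Local Notation P := (fair_coins R clock).

Lemma stopping_time_ratio (L : nat -> option nat) :
  ((fun n => xnat_ereal (L n) * ((n%:R : R)^-1)%:E)%E @ \oo --> (1 : \bar R)%E) ->
  forall r, (0 < r)%N -> exists n1, forall n, (n1 <= n)%N ->
    exists2 m, L n = Some m & (r * m <= r.+1 * n)%N.
Proof.
move=> /fine_cvgP[[M _ hM] /cvgrPdist_lt cv] r r0.
have rR : 0 < r%:R :> R by rewrite ltr0n.
have [M' _ hM'] := cv (r%:R^-1) ltac:(by rewrite invr_gt0).
exists (maxn 1 (maxn M M')) => n; rewrite !geq_max => /andP[n1 /andP[nM nM']].
have nR : 0 < n%:R :> R by rewrite ltr0n.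
have := hM n nM; have := hM' n nM'; rewrite /=.
case: (L n) => [m|] /=; last by rewrite gt0_mulye // lte_fin invr_gt0.
move=> + _; rewrite ltr_norml => /andP[+ _].
rewrite ltrBrDl => hr.
exists m => //; rewrite -(ler_nat R) !natrM -natr1.
have : m%:R / n%:R < 1 + r%:R^-1 :> R by lra.
rewrite ltr_pdivrMr // -(ltr_pM2l rR) mulrA mulrDr mulr1 divff ?gt_eqF //.
exact: ltW.
Qed.

Lemma eventually_lt1 (u : nat -> \bar R) : u @ \oo --> (0 : \bar R)%E ->
  exists M, forall n, (M <= n)%N -> (u n < 1)%E.
Proof.
move=> /fine_cvgP[[M _ hM] /cvgrPdist_lt cv].
have [M' _ hM'] := cv 1 ltr01.
exists (maxn M M') => n; rewrite geq_max => /andP[nM nM'].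
have := hM n nM; have := hM' n nM'; rewrite /= sub0r normrN => h1 fu.
by rewrite -(fineK fu) lte_fin; exact: le_lt_trans (ler_norm _) h1.
Qed.

Lemma stopping_time_ge n o m : lam n o = Some m -> (n <= m)%N.
Proof.
elim: n m => [//|n IH] m /lam_incr[m' /IH h1 h2].
exact: leq_ltn_trans h1 h2.
Qed.

(** The bound [N] makes this event depend on finitely many symbols, so that it
    passes from a process to any other that agrees with it up to time [N]. *)
Definition low_guess (k n0 N : nat) (o : nat -> bool) : Prop :=
  exists n m, [/\ (n0 <= n)%N, (m <= N)%N & lam n o = Some m] /\
    [/\ (k <= m.+1)%N, (forall i, (i < k)%N -> o (m - i)%N = false) &
        h n (mkseq o m.+1) < k.+1%:R].

Lemma low_guess_local k n0 N o o' : (forall i, (i <= N)%N -> o i = o' i) ->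
  low_guess k n0 N o -> low_guess k n0 N o'.
Proof.
move=> agr [n [m [[n0n mN lnm] [km zm hn]]]]; exists n, m; split; split => //.
- by apply: (lam_stop _ lnm) => i im; apply: agr; exact: leq_trans mN.
- by move=> i ik; rewrite -agr ?zm // (leq_trans (leq_subr _ _)).
- suff -> : mkseq o' m.+1 = mkseq o m.+1 by [].
  apply/eq_in_map => i; rewrite mem_iota ltnS => /andP[_ im].
  by rewrite agr // (leq_trans im).
Qed.

Lemma low_guess_mono k n0 N N' o : (N <= N')%N ->
  low_guess k n0 N o -> low_guess k n0 N' o.
Proof.
move=> NN' [n [m [[n0n mN lnm] hm]]]; exists n, m; split => //; split => //.
exact: leq_trans NN'.
Qed.

Lemma measurable_low_guess D k n0 N :
  measurable [set x | low_guess k n0 N (observed (@renewal_process D R) x)].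
Proof.
apply: (@measurable_local _ (coins clock) nat (fun i x => @renewal D i%:Z x)
  (iota 0 N.+1) (low_guess k n0 N)).
  by move=> i; exact: measurable_renewal.
move=> o o' agr; apply: low_guess_local => i iN; apply: agr.
by rewrite mem_iota ltnS.
Qed.

Context (consistent : forall (d : measure_display) (T : measurableType d)
      (P : probability T R) (X : int -> {RV P >-> bool}),
    stationary X -> ergodic X -> (exists k, markov_order X k) ->
    {ae P, forall t,
      ((fun n => xnat_ereal (lam n (observed X t)) * ((n%:R)^-1)%:E)%E
         @ \oo --> (1 : \bar R)%E) /\
      ((fun n => estimation_error X lam h n t) @ \oo --> (0 : \bar R)%E)}).

(** Almost surely the errors are eventually below 1 and stopping times fall
    infinitely often at the end of [k] zeros, where the memory length is at most
    [k]. So a low guess occurs almost surely at some time, and with probability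
    above 1/2 before some fixed time. *)
Lemma low_guess_stage (D : pred nat) k n0 : (forall a, D a -> (a < k)%N) ->
  exists N, 1 / 2 <
    rprob P [set x | low_guess k n0 N (observed (@renewal_process D R) x)].
Proof.
move=> Dk; pose X := @renewal_process D R.
have markovX : exists k, markov_order X k.
  by exists k; exact: renewal_markov.
have [B [mB B0 hB]] := consistent (renewal_stationary D R)
  (@renewal_ergodic D R) markovX.
pose E N := [set x | low_guess k n0 N (observed X x)].
have mE N : measurable (E N) by exact: measurable_low_guess.
have mU : measurable (\bigcup_N E N) by exact: bigcupT_measurable.
have mF := measurable_frequent_zeros D k.
have U1 : 1 <= rprob P (\bigcup_N E N).
  have F1 : rprob P (frequent_zeros D k) = 1.
    by rewrite /rprob frequent_zeros_ae.
  have Br : rprob P B = 0 by rewrite /rprob B0.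
  suff : rprob P (frequent_zeros D k) <= rprob P (\bigcup_N E N) + rprob P B.
    by rewrite F1 Br addr0.
  have := rprobU_le P mU mB; apply: le_trans.
  apply: le_rprob => //; first exact: measurableU.
    move=> x Fx; have [Bx|nBx] := pselect (B x); [by right|left].
    have [ratio err] : ((fun n => xnat_ereal (lam n (observed X x)) *
        ((n%:R)^-1)%:E)%E @ \oo --> (1 : \bar R)%E) /\
      ((fun n => estimation_error X lam h n x) @ \oo --> (0 : \bar R)%E).
      by apply: contrapT => nG; apply: nBx; exact: hB.
    have [M hM] := eventually_lt1 err.
    have [r hr] := Fx.
    have Linc n m' : lam n.+1 (observed X x) = Some m' ->
        exists2 m, lam n (observed X x) = Some m & (m < m')%N.
      exact: lam_incr.
    have [n [m [nM Lm Zm]]] := dense_times_hit Linc (stopping_time_ratio ratio) hr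
      (maxn n0 (maxn M k)).
    move: nM; rewrite !geq_max => /andP[n0n /andP[nM nk]].
    (* the block of [k] zeros must lie within the observed times *)
    have nm := stopping_time_ge Lm.
    have km : (k <= m)%N by exact: leq_trans nk nm.
    have zm i : (i < k)%N -> sample_path X x (m%:Z - i%:Z) = false.
      by have /zero_blockP := Zm; exact.
    exists m => //; exists n, m; split; split => //.
    - by rewrite ltnW.
    - move=> i ik; rewrite /observed -(zm i ik) /sample_path.
      by congr (X _ x); lia.
    have /last_blockE lb := zm.
    have memk : is_memory X (sample_path X x) m%:Z k.
      by apply: (settles_is_memory (b := false)); rewrite lb; exact: settles_zeros.
    have [k' K kk'] := memory_length_le memk.
    have := hM n nM; rewrite /estimation_error Lm K /= lte_fin.
    rewrite -natr1 ltr_norml => /andP[_].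
    have : (k'%:R : R) <= k%:R by rewrite ler_nat.
    lra.
have ndE : nondecreasing_seq E.
  by move=> N N' NN'; apply/subsetPset => x; exact: low_guess_mono.
have [N hN] := rprob_bigcup_near P (ltac:(lra) : 0 < 1 / 2 :> R) mE ndE.
by exists N; rewrite -/(E N); lra.
Qed.
End Stages.

(** * The set of levels, and low guesses on its process *)

Section Levels.
Set Implicit Arguments. Unset Strict Implicit.

Definition past_levels (s : seq nat) : nat := (\max_(a <- s) a).+1.

Lemma past_levels_gt s a : a \in s -> (a < past_levels s)%N.
Proof. by move=> sa; rewrite ltnS; exact: (leq_bigmax_seq (P := xpredT) (F := id)). Qed.

Context (next : seq nat -> nat).
Context (next_gt : forall s, (past_levels s < next s)%N).

Fixpoint levels (j : nat) : seq nat :=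
  if j is i.+1 then rcons (levels i) (next (levels i)) else [::].

Definition level (j : nat) : nat := next (levels j).

Definition level_set : pred nat := fun a => `[< exists j, a = level j >].

Lemma size_levels j : size (levels j) = j.
Proof. by elim: j => //= j IH; rewrite size_rcons IH. Qed.

Lemma mem_levels j a : (a \in levels j) <-> exists2 i, (i < j)%N & a = level i.
Proof.
elim: j => [|j IH] /=; first by split => // -[].
rewrite mem_rcons inE; split.
  case/orP => [/eqP->|/IH[i ij ->]]; first by exists j.
  by exists i => //; exact: ltnW.
move=> [i]; rewrite ltnS leq_eqVlt => /orP[/eqP-> ->|ij ai].
  by rewrite /level eqxx.
by apply/orP; right; apply/IH; exists i.
Qed.

Lemma level_gtS i j : (i < j)%N -> ((level i).+1 < level j)%N.
Proof.
move=> ij; apply: leq_trans (next_gt (levels j)).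
by rewrite ltnS; apply: past_levels_gt; apply/mem_levels; exists i.
Qed.

Lemma level_ge j : (j <= level j)%N.
Proof.
elim: j => [//|j IH]; apply: leq_ltn_trans IH _.
exact: ltnW (level_gtS (ltnSn j)).
Qed.

Lemma level_set_agree j a : (a < level j)%N -> (a \in levels j) = level_set a.
Proof.
move=> aj; apply/idP/asboolP => [/mem_levels[i _ ->]|[i ai]]; first by exists i.
apply/mem_levels; exists i => //; rewrite ltnNge; apply/negP.
rewrite leq_eqVlt => /orP[/eqP ij|/level_gtS]; first by rewrite ij -ai ltnn in aj.
by move: aj; rewrite ai; lia.
Qed.

Lemma level_set_infinite k : exists2 i, (k <= i)%N & level_set i.
Proof. by exists (level k); [exact: level_ge|apply/asboolP; exists k]. Qed.

(** Consecutive levels are never adjacent, so the successor of a level is not a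
    level. *)
Lemma level_set_coinfinite k : exists2 i, (k <= i)%N & ~~ level_set i.
Proof.
exists (level k).+1; first exact: leqW (level_ge k).
apply/negP => /asboolP[i E].
case: (ltngtP k i) => [/level_gtS|/level_gtS|ki]; rewrite -?E; [lia|lia|].
by rewrite ki in E; lia.
Qed.
End Levels.

Section Wrong.
Set Implicit Arguments. Unset Strict Implicit.
Context (R : realType).
Context (lam : nat -> (nat -> bool) -> option nat) (h : nat -> seq bool -> R).

Lemma low_guess_wrong (D : pred nat) k n0 N x :
  (forall k, exists2 i, (k <= i)%N & D i) ->
  (forall k, exists2 i, (k <= i)%N & ~~ D i) ->
  low_guess lam h k n0 N (observed (@renewal_process D R) x) ->
  exists2 n, (n0 <= n)%N & wrong_estimate (@renewal_process D R) lam h n x.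
Proof.
move=> infD coinfD [n [m [[n0n _ Lm] [km zm hn]]]]; exists n => //.
exists m => //; case K : memory_length => [k'|] //= -[hk].
have kk' : (k < k')%N.
  apply: memory_length_gt K _ => j jk; apply: zeros_not_memory => //.
  apply/last_blockE => i ij; have ik : (i < k)%N by exact: leq_trans ij jk.
  rewrite -(zm i ik) /observed /sample_path.
  by congr (@renewal_process D R _ x); lia.
by move: hn; rewrite hk ltr_nat ltnS leqNgt kk'.
Qed.

Lemma exists_far_level (k N : nat) : exists2 L, (k < L)%N &
  N.+1%:R * (3 / 4) ^+ L <= 1 / 4 :> R.
Proof.
have := @cvg_expr R (3 / 4); rewrite ger0_norm; last by lra.
have e0 : 0 < (1 / 4) / N.+1%:R :> R by rewrite divr_gt0 //; lra.
move=> /(_ ltac:(lra))/cvgrPdist_lt/(_ _ e0)[M _ /(_ (maxn M k.+1))].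
rewrite /= leq_maxl sub0r normrN ger0_norm ?exprn_ge0 ?divr_ge0 // => /(_ isT) hM.
exists (maxn M k.+1); first exact: leq_maxr.
by rewrite mulrC -ler_pdivlMr // ltW.
Qed.

Lemma infinite_setN (A : set nat) :
  (forall n0, exists2 n, (n0 <= n)%N & A n) -> infinite_set A.
Proof.
move=> hA /finite_seqP[s As]; have [n] := hA (\max_(i <- s) i).+1.
rewrite As /= => ns sn.
have := leq_bigmax_seq (P := xpredT) (F := id) n sn isT.
by rewrite leqNgt ns.
Qed.
End Wrong.

(** * The counterexample *)

Theorem theorem7 (R : realType)
  (lam : nat -> (nat -> bool) -> option nat) (h : nat -> seq bool -> R)
  (lam_stop : forall n, stopping_time (lam n))
  (lam_incr : strictly_increasing_times lam)
  (consistent : forall (d : measure_display) (T : measurableType d)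
      (P : probability T R) (X : int -> {RV P >-> bool}),
    stationary X -> ergodic X -> (exists k, markov_order X k) ->
    {ae P, forall t,
      ((fun n => xnat_ereal (lam n (observed X t)) * ((n%:R)^-1)%:E)%E
         @ \oo --> (1 : \bar R)%E) /\
      ((fun n => estimation_error X lam h n t) @ \oo --> (0 : \bar R)%E)}) :
  exists (d : measure_display) (T : measurableType d)
    (P : probability T R) (X : int -> {RV P >-> bool}),
    [/\ stationary X, ergodic X, finitarily_markovian X &
      exists E : set T, [/\ measurable E, (0 < P E)%E &
        forall t, E t -> infinite_set [set n | wrong_estimate X lam h n t]]].
Proof.
pose P := fair_coins R clock.
have /choice[f hf] (s : seq nat) : exists p : nat * nat,
    [/\ 1 / 2 < rprob P [set x | low_guess lam h (past_levels s) (size s) p.1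
           (observed (@renewal_process (mem s) R) x)],
        (past_levels s < p.2)%N &
        p.1.+1%:R * (3 / 4) ^+ p.2 <= 1 / 4 :> R].
  have [N hN] := low_guess_stage lam_stop lam_incr consistent (size s)
    (@past_levels_gt s).
  by have [L kL hL] := exists_far_level R (past_levels s) N; exists (N, L).
pose next s := (f s).2.
have next_gt s : (past_levels s < next s)%N by have [] := hf s.
pose D := level_set next; pose X := @renewal_process D R.
pose E j := [set x | low_guess lam h (past_levels (levels next j)) j
  (f (levels next j)).1 (observed X x)].
have mE j : measurable (E j) by exact: measurable_low_guess.
have PE j : 1 / 4 <= rprob P (E j).
  have [+ _ hL] := hf (levels next j); rewrite size_levels.
  set N := (f _).1 in hL *; set S := levels next j; set F := [set x | _] => hF.
  have [B [mB hB agree]] := renewal_agree_prob R N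
    (@level_set_agree next next_gt j).
  have mF : measurable F by exact: measurable_low_guess.
  have : rprob P F <= rprob P (E j `|` B).
    apply: le_rprob => //; first exact: measurableU.
    move=> x Fx; have [Bx|nBx] := pselect (B x); [by right|left].
    by apply: (low_guess_local lam_stop) Fx => n nN; exact: agree.
  have := rprobU_le P (mE j) mB.
  by lra.
pose U J := \bigcup_(j in [set j | (J <= j)%N]) E j.
have mU J : measurable (U J) by exact: bigcup_measurable.
have mI : measurable (\bigcap_J U J) by exact: bigcapT_measurable.
exists _, (coins clock), P, X; split.
- exact: renewal_stationary.
- exact: renewal_ergodic.
- exact: renewal_finitarily_markovian.
exists (\bigcap_J U J); split => //.
  rewrite (rprobE P mI) lte_fin; apply: (@lt_le_trans _ _ (1 / 4)); first by lra.
  apply: rprob_bigcap_ge => //.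
    move=> J J' JJ'; apply/subsetPset => x [j /= J'j Ex]; exists j => //=.
    exact: leq_trans J'j.
  move=> J; apply: (le_trans (PE J)); apply: le_rprob => //.
  by move=> x Ex; exists J => /=.
move=> x Ux; apply: infinite_setN => n0; have [j /= n0j Ex] := Ux n0 I.
have [n jn wn] := low_guess_wrong (level_set_infinite next_gt)
  (level_set_coinfinite next_gt) Ex.
by exists n => //; exact: leq_trans jn.
Qed.
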